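(* Let $\mathbb{\Lambda}=\{\pm\lambda^n:n\in\mathbb{Z}\}$ where $\lambda$ is one of: (i) $\lambda=2$; (ii) $\lambda=\sigma$, the plastic number; (iii) $\lambda>1$ satisfying $1=\lambda^b-\lambda^a$ for mutually prime integers $0\le a<b\le 62$ with $(a,b)\notin\{(1,3),(4,5)\}$. In cases (i) and (iii), the binary operations $\ast$ on $\mathcal{A}$ satisfying properties (P.1)–(P.5), (S.1), (S.2) are exactly the operations $$(f\ast g)(k)=c\sum_{\substack{(p,q)\in\mathbb{\Lambda}\times\mathbb{\Lambda}\\ p+q=1}} f(pk)\,g(qk),\qquad k\in\mathbb{\Lambda},$$ with $c\in\mathbb{R}$ (so the product is unique up to a real prefactor). In case (ii), they are exactly the operations $$(f\ast g)(k)=c_1\sum_{(p,q)\in T_1} f(pk)g(qk)+c_2\sum_{(p,q)\in T_2} f(pk)g(qk),\qquad k\in\mathbb{\Lambda},$$ with arbitrary $c_1,c_2\in\mathbb{R}$, where $T_1=\{(\sigma^3,-\sigma),(-\sigma,\sigma^3),(\sigma^2,-\sigma^{-1}),(-\sigma^{-1},\sigma^2),(\sigma^{-3},\sigma^{-2}),(\sigma^{-2},\sigma^{-3})\}$ and $T_2=\{(\sigma^5,-\sigma^4),(-\sigma^4,\sigma^5),(\sigma,-\sigma^{-4}),(-\sigma^{-4},\sigma),(\sigma^{-5},\sigma^{-1}),(\sigma^{-1},\sigma^{-5})\}$.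
   Context: The plastic number $\sigma\approx1.325$ is the unique real root of $x^3-x-1=0$. Let $\mathcal{A}$ be the set of functions $f:\mathbb{\Lambda}\to\mathbb{C}$ that are absolutely summable ($\sum_{k}|f(k)|<\infty$) and satisfy the reality condition $f(-k)=\overline{f(k)}$. Define the derivative $(\partial f)(k)=ik\,f(k)$, the inner product $(f,g)=\sum_{k\in\mathbb{\Lambda}} f(k)\overline{g(k)}$, and the rescaling $(\delta_\lambda f)(k)=f(\lambda k)$. A product on $\mathbb{\Lambda}$ is a binary operation $\ast$ on $\mathcal{A}$ with: (P.1) reality: $(f\ast g)(-k)=\overline{(f\ast g)(k)}$; (P.2) bilinearity over $\mathbb{R}$: $(f+\gamma g)\ast h=f\ast h+\gamma(g\ast h)$ for $\gamma\in\mathbb{R}$; (P.3) commutativity $f\ast g=g\ast f$; (P.4) associativity in average $(f\ast g,h)=(f,g\ast h)$; (P.5) Leibniz rule $\partial(f\ast g)=\partial f\ast g+f\ast\partial g$. Symmetries: (S.1) scaling invariance $\delta_\lambda(f\ast g)=\delta_\lambda f\ast\delta_\lambda g$; (S.2) parity: $(f\ast g)\circ R=(f\circ R)\ast(g\circ R)$ for $R(k)=-k$ (the one-dimensional case of the cube symmetry group). *)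

(* Defs.v *)
From Stdlib Require Import Reals List ZArith.
From Coquelicot Require Import Coquelicot.
Local Open Scope R_scope.

(* The lattice  Λ = { ± λ^n : n ∈ Z }  is indexed by  (s, n) : bool * Z,
   the element (s, n) standing for the real number  (if s then -1 else 1) * λ^n.
   For λ > 1 this indexing is a bijection onto Λ. *)
Definition Lam := (bool * Z)%type.

Definition lval (lam : R) (k : Lam) : R :=
  (if fst k then -1 else 1) * powerRZ lam (snd k).

Definition lmul (p k : Lam) : Lam := (xorb (fst p) (fst k), (snd p + snd k)%Z).

Definition lneg (k : Lam) : Lam := (negb (fst k), snd k).

Definition lpow (n : Z) : Lam := (false, n).

(* sums over Z and over Λ (used only for absolutely summable families,
   where they coincide with the unconditional sum) *)
Definition sumZ (u : Z -> R) : R :=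
  Series (fun n => u (Z.of_nat n)) + Series (fun n => u (- Z.of_nat n - 1)%Z).

Definition sumL (u : Lam -> R) : R :=
  sumZ (fun n => u (false, n) + u (true, n)).

Definition sumLC (u : Lam -> C) : C :=
  (sumL (fun k => Re (u k)), sumL (fun k => Im (u k))).

Definition abs_summable (f : Lam -> C) : Prop :=
  let v := fun n : Z => Cmod (f (false, n)) + Cmod (f (true, n)) in
  ex_series (fun n => v (Z.of_nat n)) /\ ex_series (fun n => v (- Z.of_nat n - 1)%Z).

Definition inA (f : Lam -> C) : Prop :=
  abs_summable f /\ forall k, f (lneg k) = Cconj (f k).

Definition lderiv (lam : R) (f : Lam -> C) : Lam -> C :=
  fun k => Cmult (Cmult Ci (RtoC (lval lam k))) (f k).

Definition inner (f g : Lam -> C) : C := sumLC (fun k => Cmult (f k) (Cconj (g k))).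

Definition dilate (mu : Lam) (f : Lam -> C) : Lam -> C := fun k => f (lmul mu k).

Definition binop := (Lam -> C) -> (Lam -> C) -> (Lam -> C).

Definition is_product (lam : R) (op : binop) : Prop :=
  (forall f g, inA f -> inA g -> inA (op f g)) /\
  (forall f g, inA f -> inA g -> forall k, op f g (lneg k) = Cconj (op f g k)) /\
  (forall f g h (gam : R), inA f -> inA g -> inA h -> forall k,
      op (fun x => Cplus (f x) (Cmult (RtoC gam) (g x))) h k
      = Cplus (op f h k) (Cmult (RtoC gam) (op g h k))) /\
  (forall f g, inA f -> inA g -> forall k, op f g k = op g f k) /\
  (forall f g h, inA f -> inA g -> inA h -> inner (op f g) h = inner f (op g h)) /\
  (forall f g, inA f -> inA g -> inA (lderiv lam f) -> inA (lderiv lam g) -> forall k,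
      lderiv lam (op f g) k
      = Cplus (op (lderiv lam f) g k) (op f (lderiv lam g) k)) /\
  (forall (n : Z) f g, inA f -> inA g -> forall k,
      dilate (lpow n) (op f g) k = op (dilate (lpow n) f) (dilate (lpow n) g) k) /\
  (forall f g, inA f -> inA g -> forall k,
      op f g (lneg k) = op (fun x => f (lneg x)) (fun x => g (lneg x)) k).

Definition prod_gen (lam c : R) : binop := fun f g k =>
  Cmult (RtoC c)
    (sumLC (fun p => sumLC (fun q =>
       if Req_dec_T (lval lam p + lval lam q) 1
       then Cmult (f (lmul p k)) (g (lmul q k)) else RtoC 0))).

Definition sum_pairs (T : list (Lam * Lam)) (f g : Lam -> C) (k : Lam) : C :=
  fold_right (fun pq acc => Cplus (Cmult (f (lmul (fst pq) k)) (g (lmul (snd pq) k))) acc)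
    (RtoC 0) T.

Definition lnpow (n : Z) : Lam := (true, n).

Definition T1 : list (Lam * Lam) :=
  (lpow 3, lnpow 1) :: (lnpow 1, lpow 3) ::
  (lpow 2, lnpow (-1)) :: (lnpow (-1), lpow 2) ::
  (lpow (-3), lpow (-2)) :: (lpow (-2), lpow (-3)) :: nil.

Definition T2 : list (Lam * Lam) :=
  (lpow 5, lnpow 4) :: (lnpow 4, lpow 5) ::
  (lpow 1, lnpow (-4)) :: (lnpow (-4), lpow 1) ::
  (lpow (-5), lpow (-1)) :: (lpow (-1), lpow (-5)) :: nil.

Definition prod_plastic (c1 c2 : R) : binop := fun f g k =>
  Cplus (Cmult (RtoC c1) (sum_pairs T1 f g k)) (Cmult (RtoC c2) (sum_pairs T2 f g k)).

Definition case_iii (lam : R) : Prop :=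
  exists a b : nat, (a < b)%nat /\ (b <= 62)%nat /\ Nat.gcd a b = 1%nat /\
    (a, b) <> (1%nat, 3%nat) /\ (a, b) <> (4%nat, 5%nat) /\
    1 < lam /\ 1 = lam ^ b - lam ^ a.

(* Main.v *)
(* After complex bilinear extension, a product is determined by the numbers
   C(p, q, r) = (delta_p * delta_q)(r).  The Leibniz rule forces C(p, q, r) = 0 unless p + q = r,
   and associativity in average gives (f * g)(1) = sum of C(p, q, 1) f(p) g(q) without any continuity
   assumption.  Scaling, parity and reality make C(p, q, 1) real; commutativity and associativity
   make it constant on the orbits of the symmetric group S_3 generated by (p, q) -> (q, p) and
   (p, q) -> (- q / p, 1 / p).  Conversely each orbit gives a product, and an orbit of solutions of
   p + q = 1 is the same thing as a pair (a, b) with lam^b - lam^a = 1.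

   It remains to see that such a pair is essentially unique.  Let F = X^b - X^a - 1 and
   G = X^d - X^c - 1 vanish at lam > 1, and write F = P A, G = P B with P their gcd.  As in
   Ljunggren's irreducibility argument, Q = P A* (with * the reciprocal polynomial) satisfies
   Q Q* = F F*, so that Q is again a trinomial and Q = +-F or Q = +-F*.  The second case is impossible
   because 1 / lam is not a root of F; hence A* = +-A, likewise B* = +-B, and F G* = G F*.
   Comparing exponents in this last identity leaves only (a, b) = (c, d) and the pairs
   (t, 3 t), (4 t, 5 t), that is, the plastic number when t = 1. *)

Require Import Defs.
From Stdlib Require Import Reals List ZArith.
From Coquelicot Require Import Coquelicot.
From Stdlib Require Import Lra Lia FunctionalExtensionality.
From mathcomp Require all_boot all_order all_algebra zify ring lra Rstruct.
Local Open Scope R_scope.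

(** * Trinomials with a common real root *)

Module Trinomials.
Import all_boot all_order all_algebra zify ring lra.
Import Order.TTheory GRing.Theory Num.Theory.
Set Implicit Arguments.
Unset Strict Implicit.
Unset Printing Implicit Defensive.
Local Open Scope ring_scope.

(** * Reciprocal polynomials *)

Section Reciprocal.
Variable R : idomainType.
Implicit Types p q : {poly R}.

(** This is [X^n p(1/X)] for a prescribed formal degree [n]. With [n] independent of [p] it is
    additive, and it is an involution on degrees at most [n] even when extreme coefficients
    vanish. *)
Definition recip n p : {poly R} := \poly_(i < n.+1) p`_(n - i).

Lemma coef_recip n p i : (recip n p)`_i = if (i <= n)%N then p`_(n - i) else 0.
Proof. by rewrite coef_poly ltnS. Qed.

Lemma size_recip n p : (size (recip n p) <= n.+1)%N.
Proof. exact: size_poly. Qed.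

Lemma recipK n p : (size p <= n.+1)%N -> recip n (recip n p) = p.
Proof.
move=> sp; apply/polyP=> i; rewrite !coef_recip leq_subr.
case: leqP => [le_i|lt_i]; first by rewrite subKn.
by rewrite nth_default // (leq_trans sp).
Qed.

Lemma recipD n p q : recip n (p + q) = recip n p + recip n q.
Proof.
by apply/polyP=> i; rewrite coefD !coef_recip; case: ifP; rewrite ?coefD ?addr0.
Qed.

Lemma recipZ n c p : recip n (c *: p) = c *: recip n p.
Proof.
by apply/polyP=> i; rewrite coefZ !coef_recip; case: ifP; rewrite ?coefZ ?mulr0.
Qed.

Lemma recipN n p : recip n (- p) = - recip n p.
Proof. by rewrite -scaleN1r recipZ scaleN1r. Qed.

Lemma recip_sum n m (F : 'I_m -> {poly R}) :
  recip n (\sum_(i < m) F i) = \sum_(i < m) recip n (F i).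
Proof.
apply: (big_morph (recip n)); first exact: recipD.
by apply/polyP=> i; rewrite coef_recip !coef0 if_same.
Qed.

Lemma recipXn n k : (k <= n)%N -> recip n 'X^k = 'X^(n - k).
Proof.
move=> le_k; apply/polyP=> i; rewrite coef_recip !coefXn.
by case: leqP => [le_i|lt_i]; [congr (_%:R) | rewrite gtn_eqF //]; lia.
Qed.

Lemma polyEsum n p : (size p <= n.+1)%N -> p = \sum_(i < n.+1) p`_i *: 'X^i.
Proof.
move=> sp; rewrite -poly_def; apply/polyP=> i; rewrite coef_poly.
by case: ltnP => // lt_i; rewrite nth_default // (leq_trans sp).
Qed.

Lemma recipM m n p q : (size p <= m.+1)%N -> (size q <= n.+1)%N ->
  recip (m + n) (p * q) = recip m p * recip n q.
Proof.
move=> sp sq; rewrite {1}(polyEsum sp) {1}(polyEsum sq) big_distrlr /=.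
rewrite [in RHS](polyEsum sp) [in RHS](polyEsum sq) !recip_sum big_distrlr /=.
apply: eq_bigr => i _; rewrite recip_sum; apply: eq_bigr => j _.
have [le_i le_j] := (ltn_ord i, ltn_ord j).
rewrite -scalerAl -scalerAr -exprD !recipZ !recipXn; try lia.
by rewrite -scalerAl -scalerAr -exprD; congr (_ *: (_ *: 'X^_)); lia.
Qed.

Lemma recip_eq0 n p : (size p <= n.+1)%N -> recip n p = 0 -> p = 0.
Proof.
move=> sp p0; rewrite -(recipK sp) p0.
by apply/polyP=> i; rewrite coef_recip !coef0 if_same.
Qed.
End Reciprocal.


(** * Trinomials and the product of a polynomial with its reciprocal *)

Definition tri a b : {poly int} := 'X^b - 'X^a - 1.

Lemma size_tri a b : (a < b)%N -> size (tri a b) = b.+1.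
Proof.
move=> lt_ab; have b0 : (0 < b)%N by lia.
rewrite /tri -addrA size_polyDl size_polyXn //.
apply: (leq_ltn_trans (size_polyD _ _)); rewrite !size_polyN size_polyXn size_poly1.
by rewrite ltnS geq_max lt_ab b0.
Qed.

Lemma recip_tri a b : (a < b)%N -> recip b (tri a b) = 1 - 'X^(b - a) - 'X^b.
Proof.
move=> lt_ab; rewrite /tri; have -> : 1 = 'X^0 :> {poly int} by rewrite expr0.
by rewrite !recipD !recipN !recipXn ?subnn ?subn0 // ltnW.
Qed.

(** The coefficients of this product are the autocorrelations of the coefficient sequence of [p]. *)
Lemma coef_mul_recip b (p : {poly int}) i : (i <= b)%N ->
  (p * recip b p)`_i = \sum_(j < i.+1) p`_j * p`_(b - i + j).
Proof.
move=> le_i; rewrite coefM; apply: eq_bigr => j _; have lt_j := ltn_ord j.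
by rewrite coef_recip; case: ifP => [_|/negP[]]; [congr (_ * p`__) |]; lia.
Qed.

(** The coefficient of degree [n] counts the occurrences of [n]. This turns an identity between sums
    of monomials into a matching of exponents. *)
Lemma sumXn_perm (s t : seq nat) :
  \sum_(e <- s) 'X^e = \sum_(e <- t) 'X^e :> {poly int} -> perm_eq s t.
Proof.
have coef_sumX u n : (\sum_(e <- u) 'X^e : {poly int})`_n = (count_mem n u)%:R.
  rewrite coef_sum; elim: u => [|e u IHu]; rewrite ?big_nil // big_cons IHu.
  by rewrite coefXn natrD eq_sym.
move=> eq_st; apply/allP => n _ /=; have := congr1 (fun p : {poly int} => p`_n) eq_st.
by rewrite /= !coef_sumX => /eqP; rewrite eqr_nat.
Qed.


Lemma mulz_eqN1 (x y : int) : x * y = -1 -> x = 1 /\ y = -1 \/ x = -1 /\ y = 1.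
Proof.
move=> xy; have : x \is a GRing.unit.
  by apply/unitrP; exists (- y); rewrite mulNr mulrN mulrC xy opprK.
by rewrite qualifE /= => /orP[]/eqP x1; move: xy; rewrite x1; lia.
Qed.

Lemma sum_sqr_eq1 n (x : 'I_n -> int) : \sum_(i < n) x i ^+ 2 = 1 ->
  exists k, x k ^+ 2 = 1 /\ forall i, i != k -> x i = 0.
Proof.
move=> sum1; have [k xk0] : exists k, x k != 0.
  apply/existsP; apply: contraT; rewrite negb_exists => /forallP x0.
  have := sum1; rewrite big1 // => i _.
  by have /negPn/eqP -> := x0 i; rewrite expr0n.
have := sum1; rewrite (bigD1 k) //= => sum1k.
have rest0 : 0 <= \sum_(i < n | i != k) x i ^+ 2.
  by apply: sumr_ge0 => i _; exact: sqr_ge0.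
have xk1 : 1 <= x k ^+ 2 by have := sqr_ge0 (x k); have := expf_neq0 2 xk0; lia.
have [xk_eq1 rest_eq0] : x k ^+ 2 = 1 /\ \sum_(i < n | i != k) x i ^+ 2 = 0.
  move: sum1k rest0 xk1; set u := x k ^+ 2; set v := \sum_(i < n | _) _.
  by clearbody u v; lia.
exists k; split=> //.
move=> i ik; apply/eqP; rewrite -sqrf_eq0; apply/eqP.
by apply: (psumr_eq0P _ rest_eq0) => // j _; exact: sqr_ge0.
Qed.

Lemma coef_tri a b i : (tri a b)`_i = (i == b)%:R - (i == a)%:R - (i == 0)%:R.
Proof. by rewrite /tri !coefB !coefXn coef1. Qed.

(* The coefficient of degree [b] of [Q * recip b Q] is the sum of the squares of the coefficients
   of [Q], hence [3]; the one of degree [0] is [Q`_0 * Q`_b]. *)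
Lemma trinomial_norm_shape a b (Q : {poly int}) : (0 < a < b)%N ->
  (size Q <= b.+1)%N -> Q * recip b Q = tri a b * recip b (tri a b) ->
  exists (k : nat) (al be : int), [/\ (0 < k < b)%N, al ^+ 2 = 1, be ^+ 2 = 1 &
    Q = al *: ('X^b - 1) + be *: 'X^k].
Proof.
case: b => [|b]; first by rewrite ltn0 andbF.
move=> /andP[a0 lt_ab] sQ eQ.
have Q0b : Q`_0 * Q`_b.+1 = -1.
  have := congr1 (fun p : {poly int} => p`_0) eQ.
  rewrite /= !coef_mul_recip // !big_ord1 /= !addn0 subn0 => ->.
  by rewrite !coef_tri; lia.
have [Q0E Qbsq] : Q`_0 = - Q`_b.+1 /\ Q`_b.+1 ^+ 2 = 1.
  by have [[-> ->]|[-> ->]] := mulz_eqN1 Q0b.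
have := congr1 (fun p : {poly int} => p`_b.+1) eQ.
rewrite /= !coef_mul_recip // subnn !(big_ord_recr b.+1) !(big_ord_recl b) /= !add0n.
have -> : \sum_(i < b) (tri a b.+1)`_(bump 0 i) * (tri a b.+1)`_(0 + bump 0 i) = 1.
  (* Since [bump 0 i] is [i + 1], the only nonzero inner coefficient of the trinomial, at degree
     [a], has index [a.-1]. *)
  have lt_a : (a.-1 < b)%N by lia.
  rewrite (bigD1 (Ordinal lt_a)) //= big1 ?addr0 => [|i].
    by rewrite /bump leq0n !coef_tri; lia.
  rewrite -val_eqE /= => ia; have := ltn_ord i.
  by rewrite !add0n /bump leq0n !coef_tri; lia.
have -> : (tri a b.+1)`_0 = -1 by rewrite coef_tri; lia.
have -> : (tri a b.+1)`_b.+1 = 1 by rewrite coef_tri; lia.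
move=> sumQ.
have : \sum_(i < b) Q`_(bump 0 i) ^+ 2 = 1.
  move: sumQ; rewrite -!expr2 Q0E sqrrN Qbsq; under eq_bigr do rewrite add0n -expr2.
  by set S := \sum_(i < b) _; clearbody S; lia.
move=> /sum_sqr_eq1[k [Qk1 Qk0]]; have lt_k := ltn_ord k.
exists k.+1, Q`_b.+1, Q`_k.+1; split => //.
apply/polyP => i; rewrite coefD !coefZ coefB !coefXn coef1.
have [lt_i|] := ltnP b.+1 i.
  by rewrite nth_default ?(leq_trans sQ) //; rewrite !gtn_eqF //; lia.
rewrite leq_eqVlt => /predU1P[->|lt_i].
  have -> : (b.+1 == k.+1) = false by lia.
  by rewrite eqxx subr0 mulr1 mulr0 addr0.
case: i lt_i => [|i] lt_i; first by rewrite Q0E /= !mulr0 addr0 sub0r mulrN1.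
have lt_ib : (i < b)%N by lia.
have [->|ik] := eqVneq i k; first 
  have -> : (k.+1 == b.+1 :> nat) = false by lia.
  by rewrite eqxx subr0 mulr0 mulr1 add0r.
have := Qk0 (Ordinal lt_ib); rewrite -val_eqE /= => /(_ ik) ->.
have -> : (i.+1 == b.+1) = false by lia.
by rewrite eqSS (negPf ik) subr0 !mulr0 addr0.
Qed.

(** By the previous lemma only the signs and the middle exponent [k] of [Q] are open. Comparing the
    two products forces [k = a] or [k = b - a], according to the relative sign [al * be]. *)
Lemma trinomial_of_norm a b (Q : {poly int}) : (0 < a < b)%N ->
  (size Q <= b.+1)%N -> Q * recip b Q = tri a b * recip b (tri a b) ->
  exists2 e : int, e ^+ 2 = 1 & Q = e *: tri a b \/ Q = e *: recip b (tri a b).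
Proof.
move=> ltab sQ eQ; have [k [al [be [ltk al1 be1 QE]]]] := trinomial_norm_shape ltab sQ eQ.
have lt_ab : (a < b)%N by lia.
have [Db Tb] : recip b Q = al *: (1 - 'X^b) + be *: 'X^(b - k) /\ 'X^b - 1 != 0 :> {poly int}.
  split.
    rewrite QE recipD !recipZ recipD recipN recipXn // subnn.
    have -> : 1 = 'X^0 :> {poly int} by rewrite expr0.
    by rewrite !recipXn ?subn0 //; lia.
  by rewrite -size_poly_eq0 size_XnsubC //; lia.
(* Each product is ['X^b - 1] times one side of this identity, plus the common term
   ['X^b - ('X^b - 1)^2]. *)
have key : (al * be) *: ('X^(b - k) - 'X^k) = - ('X^(b - a) - 'X^a) :> {poly int}.
  apply: (mulfI Tb); move: eQ; rewrite Db QE recip_tri // /tri.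
  have -> : 'X^b = 'X^k * 'X^(b - k) :> {poly int} by rewrite -exprD subnKC //; lia.
  have E : 'X^a * 'X^(b - a) = 'X^k * 'X^(b - k) :> {poly int}.
    by rewrite -!exprD !subnKC //; lia.
  rewrite -!mul_polyC polyCM.
  have alC : al%:P ^+ 2 = 1 :> {poly int} by rewrite -rmorphXn al1.
  have beC : be%:P ^+ 2 = 1 :> {poly int} by rewrite -rmorphXn be1.
  move: alC beC E; move: al%:P be%:P 'X^a 'X^(b-a) 'X^k 'X^(b-k) => u v x y z t u1 v1 xy.
  have -> : (u * (z * t - 1) + v * z) * (u * (1 - z * t) + v * t) =
      (z * t - 1) * (u * v * (t - z)) - u ^+ 2 * (z * t - 1) ^+ 2 + v ^+ 2 * (z * t).
    by ring.
  have -> : (z * t - x - 1) * (1 - y - z * t) =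
      (z * t - 1) * - (y - x) - (z * t - 1) ^+ 2 + x * y by ring.
  by rewrite u1 v1 xy !mul1r => /addIr/addIr.
have albe : (al * be) ^+ 2 = 1 by rewrite exprMn al1 be1.
have : al * be = 1 \/ al * be = -1 by apply/pred2P; rewrite -sqrf_eq1 albe.
have be_al : be = (al * be) * al by rewrite mulrAC -expr2 al1 mul1r.
case=> ab1; move: key; rewrite ab1.
  rewrite scale1r => key; exists (- al); first by rewrite sqrrN.
  have /perm_mem P1 : perm_eq [:: (b - k)%N; (b - a)%N] [:: a; k].
    apply: sumXn_perm; rewrite !big_cons !big_nil !addr0.
    move: key; move: 'X^a 'X^(b-a) 'X^k 'X^(b-k) => x y z t key.
    have -> : t + y = (t - z) + (y + z) by ring.
    by rewrite key; ring.
  have kE : k = (b - a)%N.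
    by have := P1 k; have := P1 a; rewrite !inE !eqxx; lia.
  right; rewrite QE be_al ab1 kE recip_tri // mul1r scaleNr -scalerN -scalerDr.
  by congr (_ *: _); ring.
rewrite scaleN1r => /oppr_inj key; exists al => //; left.
have /perm_mem P1 : perm_eq [:: (b - k)%N; a] [:: (b - a)%N; k].
  apply: sumXn_perm; rewrite !big_cons !big_nil !addr0.
  move: key; move: 'X^a 'X^(b-a) 'X^k 'X^(b-k) => x y z t key.
  have -> : t + x = (t - z) + (x + z) by ring.
  by rewrite key; ring.
have kE : k = a by have := P1 k; have := P1 a; rewrite !inE !eqxx; lia.
rewrite QE be_al ab1 kE mulN1r scaleNr -scalerN -scalerDr.
by congr (_ *: _); rewrite /tri; ring.
Qed.

(** [trinomial_of_norm] is applied to [Q = P * recip n A]. If [Q] is the trinomial up to sign,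
    cancelling [P] gives the statement on [A]; if it is its reciprocal, cancelling [recip n A] gives
    the one on [P]. *)
Lemma ljunggren a b m n (P A : {poly int}) : (0 < a < b)%N -> tri a b = P * A ->
  size P = m.+1 -> size A = n.+1 ->
  (recip m P = P \/ recip m P = - P) \/ (recip n A = A \/ recip n A = - A).
Proof.
move=> ltab FE sP sA.
have P0 : P != 0 by rewrite -size_poly_eq0 sP.
have A0 : A != 0 by rewrite -size_poly_eq0 sA.
have bE : b = (m + n)%N.
  have := size_mul P0 A0; rewrite -FE size_tri; last by case/andP: ltab.
  by rewrite sP sA; lia.
have sA' := size_recip n A.
have sQ : (size (P * recip n A)%R <= b.+1)%N.
  by apply: (leq_trans (size_polyMleq _ _)); rewrite sP bE addSn /= -addnS leq_add2l.
have rQ : recip b (P * recip n A) = recip m P * A.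
  by rewrite bE recipM ?sP // recipK ?sA.
have rF : recip b (tri a b) = recip m P * recip n A.
  by rewrite FE bE recipM ?sP ?sA.
have sgn (e : int) (p q : {poly int}) : e ^+ 2 = 1 -> p = e *: q -> p = q \/ p = - q.
  move=> /eqP; rewrite sqrf_eq1 => /pred2P[] -> ->; rewrite ?scaleN1r ?scale1r; by [left|right].
have [|e e1 [QE|QE]] := @trinomial_of_norm a b (P * recip n A) ltab sQ.
- by rewrite rQ rF FE; ring.
- right; apply: (sgn e) => //; apply: (mulfI P0); by rewrite QE FE scalerAr.
left; apply: (sgn e) => //.
have rA0 : recip n A != 0 by apply: contraNneq A0 => /(@recip_eq0 _ n A); rewrite sA => ->.
have e_e : e * e = 1 by rewrite -expr2.
apply: (mulIf rA0); rewrite -scalerAl QE rF scalerA e_e scale1r.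
by [].
Qed.

(** Equal sums of the two lists give [3 (d - b) = 2 (c - a)]. If [a < c], then [a] must occur in the
    first list, which is possible only as [d - c]; locating [b - a] there as well then leaves
    [b = 3 a]. The case [c < a] is symmetric. *)
Lemma exponents_of_perm a b c d : (0 < a < b)%N -> (0 < c < d)%N ->
  perm_eq [:: c; b - a + d; a + (d - c); d - c; a + d]%N
          [:: a; b + (d - c); c + (b - a); b - a; c + b]%N ->
  [\/ a = c /\ b = d, [/\ b = 3 * a, c = 4 * a & d = 5 * a]%N
    | [/\ d = 3 * c, a = 4 * c & b = 5 * c]%N].
Proof.
move=> ltab ltcd pE.
have := perm_sumn pE; rewrite /= !addn0 => sumE.
have [ac|ac] := eqVneq a c; first by constructor 1; split=> //; lia.
have [ltac|ltca] : (a < c \/ c < a)%N by lia.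
  have /esym := perm_mem pE a; have /esym := perm_mem pE (b - a)%N.
  rewrite !inE !eqxx /= !orbT => h1 h2; constructor 2.
  have {h2} dE' : a = (d - c)%N by lia.
  by split; lia.
have := perm_mem pE c; have := perm_mem pE (d - c)%N.
rewrite !inE !eqxx /= !orbT => h1 h2; constructor 3.
have {h2} dE' : c = (b - a)%N by lia.
by split; lia.
Qed.

(** * Two integer polynomials with a common root *)

Section CommonRoot.
Variables (K : realFieldType) (x : K).
Implicit Types F G P A B : {poly int}.
Local Notation toK P := (map_poly (intr : int -> K) P).

(** The gcd is taken over the rationals: it is compatible with the extension to [K], hence still
    vanishes at [x]. Gauss's lemma for its primitive part brings the factorizations back to integer
    coefficients. *)
Lemma common_factor F G : root (toK F) x -> root (toK G) x ->
  exists P A B : {poly int}, [/\ F = P * A, G = P * B & root (toK P) x].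
Proof.
move=> Fx Gx; set pQ := gcdp (map_poly (intr : int -> rat) F) (map_poly intr G).
have [p [a a0 pE]] := rat_poly_scale pQ.
have dvd q : pQ %| map_poly intr q -> {r | q = zprimitive p * r}.
  by rewrite pE dvdpZl ?invr_eq0 ?intr_eq0 // dvdp_rat_int => /dvdpP_int.
have [A FE] := dvd F (dvdp_gcdl _ _); have [B GE] := dvd G (dvdp_gcdr _ _).
have ratrE (q : {poly int}) : map_poly ratr (map_poly (intr : int -> rat) q) = toK q.
  by rewrite -map_poly_comp; apply: eq_map_poly => z /=; rewrite ratr_int.
exists (zprimitive p), A, B; split => //.
have : root (map_poly ratr pQ) x by rewrite gcdp_map root_gcd !ratrE Fx Gx.
rewrite pE linearZ /= ratrE rootZ; last by rewrite fmorph_eq0 invr_eq0 intr_eq0.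
have [->|p0] := eqVneq p 0; first by rewrite zprimitive0.
rewrite {1}[p]zpolyEprim map_polyZ /= rootZ // intr_eq0 zcontents_eq0 //.
Qed.

Lemma root_tri a b : root (toK (tri a b)) x = (x ^+ b - x ^+ a == 1).
Proof.
by rewrite /tri !rmorphB /= !map_polyXn rmorph1 rootE !hornerE subr_eq0.
Qed.

Hypothesis x1 : 1 < x.

Lemma tri_lt a b : x ^+ b - x ^+ a = 1 -> (a < b)%N.
Proof.
move=> xab; rewrite -(ltr_eXn2l x1) -subr_gt0 xab; exact: ltr01.
Qed.

(** In the other alternative of [ljunggren], [x] would also be a root of the reciprocal trinomial
    [1 - X^(b-a) - X^b], which is negative at [x > 1]. *)
Lemma recip_cofactor a b P A n : (0 < a < b)%N -> tri a b = P * A ->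
  root (toK P) x -> size A = n.+1 -> recip n A = A \/ recip n A = - A.
Proof.
move=> ltab FE Px sA; have [m sP] : exists m, size P = m.+1.
  exists (size P).-1; rewrite prednK // size_poly_gt0.
  apply/eqP => P0; move: (size_tri (proj2 (andP ltab))).
  by rewrite FE P0 mul0r size_poly0.
have [rP|//] := ljunggren ltab FE sP sA.
have lt_ab : (a < b)%N by lia.
have : root (toK (recip b (tri a b))) x.
  have bE : b = (m + n)%N.
    have := size_tri lt_ab; rewrite FE size_mul -?size_poly_eq0 ?sP ?sA //; lia.
  rewrite FE bE recipM ?sP ?sA // rmorphM rootM.
  by case: rP => ->; rewrite ?rmorphN ?rootN Px.
rewrite recip_tri // !rmorphB /= !map_polyXn rmorph1 rootE !hornerE.
have xb : 1 < x ^+ b by rewrite exprn_egt1 // -lt0n; lia.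
have xc : 0 < x ^+ (b - a) by rewrite exprn_gt0 // (lt_trans ltr01).
by rewrite subr_eq0 => /eqP uE; move: xb; rewrite -uE ltNge lerBlDr lerDl ltW.
Qed.

Lemma trinomial_exponents a b c d : (0 < a)%N -> (0 < c)%N ->
  x ^+ b - x ^+ a = 1 -> x ^+ d - x ^+ c = 1 ->
  [\/ a = c /\ b = d, [/\ b = 3 * a, c = 4 * a & d = 5 * a]%N
    | [/\ d = 3 * c, a = 4 * c & b = 5 * c]%N].
Proof.
move=> a0 c0 xab xcd; have [lt_ab lt_cd] := (tri_lt xab, tri_lt xcd).
have [||P [A [B [FE GE Px]]]] := @common_factor (tri a b) (tri c d).
- by rewrite root_tri xab.
- by rewrite root_tri xcd.
have [[m sP] [n sA] [k sB]] : [/\ exists m, size P = m.+1,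
    exists n, size A = n.+1 & exists k, size B = k.+1].
  have [F0 G0] : tri a b != 0 /\ tri c d != 0.
    by rewrite -!size_poly_eq0 !size_tri.
  have nz (p : {poly int}) : p != 0 -> exists l, size p = l.+1.
    by rewrite -size_poly_gt0; case: (size p) => // l _; exists l.
  move: F0 G0; rewrite FE GE !mulf_eq0 !negb_or => /andP[P0 A0] /andP[_ B0].
  by split; apply: nz.
have lt0ab : (0 < a < b)%N by lia.
have lt0cd : (0 < c < d)%N by lia.
have rA := recip_cofactor lt0ab FE Px sA; have rB := recip_cofactor lt0cd GE Px sB.
have sz p q i j : p != 0 -> q != 0 -> size (p : {poly int}) = i.+1 ->
    size (q : {poly int}) = j.+1 -> size (p * q) = (i + j).+1.
  by move=> p0 q0 sp sq; rewrite size_mul // sp sq addSn /= addnS.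
have [P0 A0 B0] : [/\ P != 0, A != 0 & B != 0] by rewrite -!size_poly_eq0 sP sA sB.
have bE : b = (m + n)%N.
  by have := size_tri lt_ab; rewrite FE (sz _ _ m n) //; lia.
have dE : d = (m + k)%N.
  by have := size_tri lt_cd; rewrite GE (sz _ _ m k) //; lia.
have rF : recip b (tri a b) = recip m P * recip n A.
  by rewrite FE bE recipM ?sP ?sA.
have rG : recip d (tri c d) = recip m P * recip k B.
  by rewrite GE dE recipM ?sP ?sB.
have : tri a b * recip d (tri c d) = tri c d * recip b (tri a b).
  have : tri a b * recip d (tri c d) = tri c d * recip b (tri a b) \/
         tri a b * recip d (tri c d) = - (tri c d * recip b (tri a b)).
    rewrite rF rG FE GE.
    by case: rA => ->; case: rB => ->; rewrite ?mulrN ?opprK;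
      [left|right|right|left]; ring.
  (* Both products have constant coefficient [-1], which excludes the minus sign. *)
  case=> // /(congr1 (fun p : {poly int} => p`_0)).
  have T0 i j : (0 < i < j)%N -> (tri i j)`_0 = -1 by move=> ?; rewrite coef_tri; lia.
  have Tn i j : (0 < i < j)%N -> (tri i j)`_j = 1 by move=> ?; rewrite coef_tri; lia.
  by rewrite coefN !coef0M !coef_recip !subn0 /= !T0 // !Tn.
rewrite !recip_tri // /tri => key.
(* After expansion ['X^b], ['X^d], ['X^(b + d)] and [1] cancel. Moving the remaining terms to the
   side where their sign is positive leaves five monomials on each side. *)
have pE : perm_eq [:: c; b - a + d; a + (d - c); d - c; a + d]%N
                  [:: a; b + (d - c); c + (b - a); b - a; c + b]%N.
  apply: sumXn_perm; rewrite !big_cons !big_nil !exprD.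
  move: key; move: 'X^a 'X^b 'X^c 'X^d 'X^(b - a) 'X^(d - c) => xa xb xc xd y z key.
  apply/eqP; rewrite -subr_eq0; apply/eqP; move/eqP: key; rewrite -subr_eq0 => /eqP <-.
  by ring.
exact: exponents_of_perm pE.
Qed.

(* The common factor of ['X^d - 2] and the trinomial is monic up to sign; modulo 2 it divides
   ['X^d], but the trinomial does not vanish at 0. *)
Lemma pow_eq2_trinomial a b d : (0 < a)%N -> x ^+ b - x ^+ a = 1 -> x ^+ d <> 2.
Proof.
move=> a0 xab xd; have lt_ab := tri_lt xab.
have [||P [A [B [FE GE Px]]]] := @common_factor (tri a b) ('X^d - 2%:P).
- by rewrite root_tri xab.
- by rewrite rmorphB /= map_polyXn map_polyC rootE !hornerE xd subrr.
pose to2 (p : {poly int}) := map_poly (intr : int -> 'F_2) p.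
have lP : (lead_coef P)%:~R != 0 :> 'F_2.
  have lF : lead_coef (tri a b) = 1.
    by rewrite lead_coefE size_tri //= coef_tri; lia.
  apply/eqP => lP0; have := congr1 (intr : int -> 'F_2) lF.
  rewrite FE lead_coefM rmorphM /= lP0 mul0r => /eqP.
  by rewrite eq_sym oner_eq0.
have sP : size (to2 P) = size P by apply: size_map_poly_id0.
have dvdX : to2 P %| ('X - 0%:P) ^+ d.
  apply/dvdpP; exists (to2 B); rewrite mulrC /to2 -rmorphM -GE rmorphB /=.
  rewrite map_polyXn map_polyC /= subr0; have -> : 2%:~R = 0 :> 'F_2 by apply/val_inj.
  by rewrite polyC0 subr0.
have P0 : size P != 1.
  apply: contraTneq Px => /eqP/size_poly1P[c c0 ->].
  by rewrite map_polyC rootC intr_eq0.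
have /dvdp_exp_XsubCP[k [le_k eqP]] := dvdX.
have := eqp_size eqP; rewrite sP size_exp_XsubC => sPk.
have : root (to2 (tri a b)) 0.
  rewrite FE /to2 rmorphM rootM; apply/orP; left.
  rewrite (eqp_root eqP) rootE horner_exp hornerXsubC subrr expr0n.
  by case: (k) sPk P0 => [->|].
rewrite /to2 /tri !rmorphB /= !map_polyXn rmorph1 rootE !hornerE !expr0n.
by rewrite !gtn_eqF //; lia.
Qed.

End CommonRoot.
End Trinomials.

(** * Transfer of the two results to the standard real numbers *)

Lemma trinomial_exponents (x : R) (a b c d : nat) :
  1 < x -> (0 < a)%nat -> (0 < c)%nat -> x ^ b - x ^ a = 1 -> x ^ d - x ^ c = 1 ->
  a = c /\ b = d \/ (b = 3 * a /\ c = 4 * a /\ d = 5 * a)%nat \/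
  (d = 3 * c /\ a = 4 * c /\ b = 5 * c)%nat.
Proof.
  intros x1 a0 c0 xab xcd; rewrite !Rstruct.RpowE in xab, xcd.
  destruct (@Trinomials.trinomial_exponents Rstruct.RbaseSymbolsImpl_R__canonical__Num_RealField
    _ (ssrbool.introT Rstruct.RltP x1) _ _ _ _ (ssrbool.introT ssrnat.ltP a0)
    (ssrbool.introT ssrnat.ltP c0) xab xcd) as [H | [? ? ?] | [? ? ?]]; auto.
Qed.

Lemma pow_neq_2 (x : R) (a b d : nat) :
  1 < x -> (0 < a)%nat -> x ^ b - x ^ a = 1 -> x ^ d <> 2.
Proof.
  intros x1 a0 xab; rewrite !Rstruct.RpowE in xab; rewrite Rstruct.RpowE.
  exact (@Trinomials.pow_eq2_trinomial Rstruct.RbaseSymbolsImpl_R__canonical__Num_RealField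
    _ (ssrbool.introT Rstruct.RltP x1) _ _ _ (ssrbool.introT ssrnat.ltP a0) xab).
Qed.

(** * Unconditional sums over the lattice *)

(** Convergence of the two halves of [sumZ] has to be recorded apart, because [Series] is total. *)
Definition exZ (u : Z -> R) : Prop :=
  ex_series (fun n => u (Z.of_nat n)) /\ ex_series (fun n => u (- Z.of_nat n - 1)%Z).

Definition exL (u : Lam -> R) : Prop := exZ (fun n => u (false, n) + u (true, n)).

Lemma sumZ_ext (u v : Z -> R) : (forall n, u n = v n) -> sumZ u = sumZ v.
Proof. intros E; f_equal; now apply functional_extensionality. Qed.

Lemma exZ_plus u v : exZ u -> exZ v -> exZ (fun n => u n + v n).
Proof.
  intros [H1 H2] [H3 H4]; split;
    [apply (ex_series_plus _ _ H1 H3) | apply (ex_series_plus _ _ H2 H4)].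
Qed.

Lemma exZ_scal r u : exZ u -> exZ (fun n => r * u n).
Proof.
  intros [H1 H2]; split; [apply (ex_series_scal r _ H1) | apply (ex_series_scal r _ H2)].
Qed.

Lemma exZ_le u v : (forall n, Rabs (u n) <= v n) -> exZ v -> exZ u.
Proof.
  intros Huv [H1 H2]; split.
  - apply (ex_series_le (V := R_CompleteNormedModule) _ _ (fun n => Huv _) H1).
  - apply (ex_series_le (V := R_CompleteNormedModule) _ _ (fun n => Huv _) H2).
Qed.

Lemma sumZ_plus u v : exZ u -> exZ v -> sumZ (fun n => u n + v n) = sumZ u + sumZ v.
Proof.
  intros [H1 H2] [H3 H4]; unfold sumZ.
  rewrite (Series_plus _ _ H1 H3), (Series_plus _ _ H2 H4); ring.
Qed.

Lemma sumZ_scal r u : sumZ (fun n => r * u n) = r * sumZ u.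
Proof. unfold sumZ; rewrite 2!Series_scal_l; ring. Qed.

(** The unit shift moves the single term [u 0] from the nonnegative half of the series to the
    negative half. *)
Lemma sumZ_succ u : exZ u ->
  exZ (fun n => u (n + 1)%Z) /\ sumZ (fun n => u (n + 1)%Z) = sumZ u.
Proof.
  intros [H1 H2].
  assert (E1 : (fun n => u (Z.of_nat n + 1)%Z) = (fun n => u (Z.of_nat (S n)))).
  { apply functional_extensionality; intros n; f_equal; lia. }
  set (w := fun n => u (- Z.of_nat n - 1 + 1)%Z).
  assert (E2 : (fun n => w (S n)) = (fun n => u (- Z.of_nat n - 1)%Z)).
  { apply functional_extensionality; intros n; unfold w; f_equal; lia. }
  assert (Hw : ex_series w) by (apply ex_series_incr_1; now rewrite E2).
  split.
  - split; [rewrite E1; now apply (ex_series_incr_1 (fun n => u (Z.of_nat n))) | exact Hw].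
  - unfold sumZ; rewrite E1; fold w.
    rewrite (Series_incr_1 w Hw), E2, (Series_incr_1 _ H1).
    unfold w; simpl; ring.
Qed.

Lemma sumZ_pred u : exZ u ->
  exZ (fun n => u (n - 1)%Z) /\ sumZ (fun n => u (n - 1)%Z) = sumZ u.
Proof.
  intros [H1 H2].
  assert (E1 : (fun n => u (- Z.of_nat n - 1 - 1)%Z) = (fun n => u (- Z.of_nat (S n) - 1)%Z)).
  { apply functional_extensionality; intros n; f_equal; lia. }
  set (w := fun n => u (Z.of_nat n - 1)%Z).
  assert (E2 : (fun n => w (S n)) = (fun n => u (Z.of_nat n))).
  { apply functional_extensionality; intros n; unfold w; f_equal; lia. }
  assert (Hw : ex_series w) by (apply ex_series_incr_1; now rewrite E2).
  split.
  - split; [exact Hw | rewrite E1; now apply (ex_series_incr_1 (fun n => u (- Z.of_nat n - 1)%Z))].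
  - unfold sumZ; rewrite E1; fold w.
    rewrite (Series_incr_1 w Hw), E2, (Series_incr_1 _ H2).
    unfold w; simpl; ring.
Qed.

Lemma sumZ_shift m u : exZ u ->
  exZ (fun n => u (m + n)%Z) /\ sumZ (fun n => u (m + n)%Z) = sumZ u.
Proof.
  revert u; pattern m; apply Z.peano_ind; clear m.
  - intros u Hu; split; [apply Hu | reflexivity].
  - intros m IH u Hu; destruct (IH u Hu) as [H1 H2].
    destruct (sumZ_succ _ H1) as [H3 H4]; rewrite <- H2, <- H4.
    replace (fun n => u (Z.succ m + n)%Z) with (fun n => u (m + (n + 1))%Z); [easy|].
    apply functional_extensionality; intros n; f_equal; lia.
  - intros m IH u Hu; destruct (IH u Hu) as [H1 H2].
    destruct (sumZ_pred _ H1) as [H3 H4]; rewrite <- H2, <- H4.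
    replace (fun n => u (Z.pred m + n)%Z) with (fun n => u (m + (n - 1))%Z); [easy|].
    apply functional_extensionality; intros n; f_equal; lia.
Qed.

Lemma sumZ_at0 u : (forall n, n <> 0%Z -> u n = 0) -> exZ u /\ sumZ u = u 0%Z.
Proof.
  intros Hu.
  assert (H : forall a : nat -> R, (forall n, a (S n) = 0) -> is_series a (a 0%nat)).
  { intros a Ha; unfold is_series.
    apply filterlim_ext with (fun _ : nat => a 0%nat); [|apply filterlim_const].
    induction x as [|n IH]; [now rewrite sum_O|].
    rewrite sum_Sn, <- IH, Ha; symmetry; apply Rplus_0_r. }
  assert (H1 : is_series (fun n => u (Z.of_nat n)) (u 0%Z)).
  { apply (H (fun n => u (Z.of_nat n))); intros n; apply Hu; lia. }
  assert (H2 : is_series (fun n => u (- Z.of_nat n - 1)%Z) (u (-1)%Z)).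
  { apply (H (fun n => u (- Z.of_nat n - 1)%Z)); intros n; apply Hu; lia. }
  split; [split; eexists; eassumption|].
  unfold sumZ; rewrite (is_series_unique _ _ H1), (is_series_unique _ _ H2), (Hu (-1)%Z);
    [ring|lia].
Qed.

Lemma sumL_plus u v : exL u -> exL v -> sumL (fun k => u k + v k) = sumL u + sumL v.
Proof.
  intros Hu Hv; unfold sumL; rewrite <- sumZ_plus by assumption.
  apply sumZ_ext; intros; ring.
Qed.

Lemma sumL_scal r u : sumL (fun k => r * u k) = r * sumL u.
Proof. unfold sumL; rewrite <- sumZ_scal; apply sumZ_ext; intros; ring. Qed.

(** Multiplication by [(s, m)] shifts the exponent by [m], and the sign [s] can only exchange the
    two terms that are added at each exponent. *)
Lemma sumL_lmul p u : exL u ->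
  exL (fun k => u (lmul p k)) /\ sumL (fun k => u (lmul p k)) = sumL u.
Proof.
  intros Hu; destruct p as [s m].
  destruct (sumZ_shift m _ Hu) as [H1 H2]; unfold exL, sumL, lmul; rewrite <- H2; simpl.
  destruct s; simpl; [|easy].
  replace (fun n => u (true, (m + n)%Z) + u (false, (m + n)%Z))
    with (fun n => u (false, (m + n)%Z) + u (true, (m + n)%Z)); [easy|].
  apply functional_extensionality; intros; ring.
Qed.

Lemma abs_summable_le f (v : Lam -> R) :
  (forall k, Cmod (f k) <= v k) -> exL v -> abs_summable f.
Proof.
  intros Hv; apply exZ_le; intros n.
  rewrite Rabs_pos_eq; [apply Rplus_le_compat; apply Hv|].
  apply Rplus_le_le_0_compat; apply Cmod_ge_0.
Qed.

Lemma exL_le u f : (forall k, Rabs (u k) <= Cmod (f k)) -> abs_summable f -> exL u.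
Proof.
  intros Hu; apply exZ_le; intros n.
  eapply Rle_trans; [apply Rabs_triang | apply Rplus_le_compat; apply Hu].
Qed.

Lemma exL_plus u v : exL u -> exL v -> exL (fun k => u k + v k).
Proof.
  intros Hu Hv; generalize (exZ_plus _ _ Hu Hv); unfold exL.
  match goal with |- exZ ?x -> exZ ?y => replace y with x; [easy|] end.
  apply functional_extensionality; intros; ring.
Qed.

Lemma exL_scal r u : exL u -> exL (fun k => r * u k).
Proof.
  intros Hu; generalize (exZ_scal r _ Hu); unfold exL.
  match goal with |- exZ ?x -> exZ ?y => replace y with x; [easy|] end.
  apply functional_extensionality; intros; ring.
Qed.

Lemma abs_summable_plus f g :
  abs_summable f -> abs_summable g -> abs_summable (fun k => Cplus (f k) (g k)).
Proof.
  intros Hf Hg; apply (abs_summable_le _ _ (fun k => Cmod_triangle (f k) (g k))).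
  now apply exL_plus.
Qed.

Lemma abs_summable_scal c f : abs_summable f -> abs_summable (fun k => Cmult c (f k)).
Proof.
  intros Hf; apply (abs_summable_le _ (fun k => Cmod c * Cmod (f k))).
  - intros k; rewrite Cmod_mult; apply Rle_refl.
  - now apply exL_scal.
Qed.

Lemma abs_summable_lmul p f : abs_summable f -> abs_summable (fun k => f (lmul p k)).
Proof. intros Hf; exact (proj1 (sumL_lmul p (fun k => Cmod (f k)) Hf)). Qed.

(** Negation is by computation the multiplication by [(true, 0)], the element [-1]. *)
Lemma abs_summable_lneg f : abs_summable f -> abs_summable (fun k => f (lneg k)).
Proof. exact (abs_summable_lmul (true, 0%Z) f). Qed.

Lemma abs_summable_conj f : abs_summable f -> abs_summable (fun k => Cconj (f k)).
Proof.
  intros Hf; apply (abs_summable_le _ (fun k => Cmod (f k))); [|exact Hf].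
  intros k; rewrite Cmod_conj; apply Rle_refl.
Qed.

Lemma abs_summable_bounded f : abs_summable f -> exists M, forall k, Cmod (f k) <= M.
Proof.
  assert (B : forall a : nat -> R, ex_series a -> exists M, forall n, Rabs (a n) <= M).
  { intros a Ha; apply ex_series_lim_0 in Ha.
    destruct (filterlim_bounded a) as [M HM]; [now exists 0|].
    exists M; exact HM. }
  intros [H1 H2]; destruct (B _ H1) as [M1 HM1]; destruct (B _ H2) as [M2 HM2].
  exists (M1 + M2); intros [s n].
  assert (Hn : exists m : nat, n = Z.of_nat m \/ n = (- Z.of_nat m - 1)%Z).
  { destruct (Z_le_gt_dec 0 n); [exists (Z.to_nat n) | exists (Z.to_nat (- n - 1))]; lia. }
  destruct Hn as [m Hn]; specialize (HM1 m); specialize (HM2 m).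
  assert (P1 := Rabs_pos (Cmod (f (false, Z.of_nat m)) + Cmod (f (true, Z.of_nat m)))).
  assert (P2 := Rabs_pos (Cmod (f (false, (- Z.of_nat m - 1)%Z))
                          + Cmod (f (true, (- Z.of_nat m - 1)%Z)))).
  assert (Q : forall n, Cmod (f (s, n)) <= Rabs (Cmod (f (false, n)) + Cmod (f (true, n)))).
  { intros j; eapply Rle_trans; [|apply Rle_abs].
    generalize (Cmod_ge_0 (f (false, j))) (Cmod_ge_0 (f (true, j))).
    destruct s; lra. }
  destruct Hn as [-> | ->].
  - generalize (Q (Z.of_nat m)); lra.
  - generalize (Q (- Z.of_nat m - 1)%Z); lra.
Qed.

Lemma abs_summable_mult f g :
  abs_summable f -> abs_summable g -> abs_summable (fun k => Cmult (f k) (g k)).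
Proof.
  intros Hf Hg; destruct (abs_summable_bounded f Hf) as [M HM].
  apply (abs_summable_le _ (fun k => M * Cmod (g k))); [|now apply exL_scal].
  intros k; rewrite Cmod_mult.
  apply Rmult_le_compat_r; [apply Cmod_ge_0 | apply HM].
Qed.

Lemma exL_Re f : abs_summable f -> exL (fun k => Re (f k)).
Proof. apply exL_le; intros k; apply re_le_Cmod. Qed.

Lemma exL_Im f : abs_summable f -> exL (fun k => Im (f k)).
Proof. apply exL_le; intros k; eapply Rle_trans; [apply Rmax_r | apply Rmax_Cmod]. Qed.

Lemma sumLC_ext (f g : Lam -> C) : (forall k, f k = g k) -> sumLC f = sumLC g.
Proof. intros E; f_equal; now apply functional_extensionality. Qed.

Lemma sumLC_plus f g : abs_summable f -> abs_summable g ->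
  sumLC (fun k => Cplus (f k) (g k)) = Cplus (sumLC f) (sumLC g).
Proof.
  intros Hf Hg; unfold sumLC, Cplus; simpl; f_equal; rewrite <- sumL_plus;
    auto using exL_Re, exL_Im.
Qed.

Lemma sumLC_scal c f : abs_summable f ->
  sumLC (fun k => Cmult c (f k)) = Cmult c (sumLC f).
Proof.
  intros Hf; unfold sumLC, Cmult; simpl; f_equal.
  - unfold Rminus; rewrite Ropp_mult_distr_l, <- 2!sumL_scal, <- sumL_plus
      by auto using exL_scal, exL_Re, exL_Im.
    f_equal; apply functional_extensionality; intros k; unfold Re, Im; ring.
  - rewrite <- 2!sumL_scal, <- sumL_plus by auto using exL_scal, exL_Re, exL_Im.
    reflexivity.
Qed.

Lemma sumLC_lmul p f : abs_summable f -> sumLC (fun k => f (lmul p k)) = sumLC f.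
Proof.
  intros Hf; unfold sumLC; f_equal.
  - exact (proj2 (sumL_lmul p _ (exL_Re f Hf))).
  - exact (proj2 (sumL_lmul p _ (exL_Im f Hf))).
Qed.

Lemma sumLC_lneg f : abs_summable f -> sumLC (fun k => f (lneg k)) = sumLC f.
Proof. exact (sumLC_lmul (true, 0%Z) f). Qed.

(** * The multiplicative group of the lattice *)

Lemma Lam_eq_dec (p q : Lam) : {p = q} + {p <> q}.
Proof. decide equality; [apply Z.eq_dec | apply Bool.bool_dec]. Defined.

Definition linv (p : Lam) : Lam := (fst p, (- snd p)%Z).

Lemma lmul_comm p q : lmul p q = lmul q p.
Proof. unfold lmul; f_equal; [apply Bool.xorb_comm | apply Z.add_comm]. Qed.

Lemma lmul_assoc p q r : lmul p (lmul q r) = lmul (lmul p q) r.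
Proof.
  unfold lmul; simpl; f_equal; [now rewrite Bool.xorb_assoc | apply Z.add_assoc].
Qed.

Lemma lmul_1_l p : lmul (lpow 0) p = p.
Proof. destruct p as [[|] n]; reflexivity. Qed.

Lemma lmul_linv_l p : lmul (linv p) p = lpow 0.
Proof. unfold lmul, linv, lpow; simpl; f_equal; [apply Bool.xorb_nilpotent | lia]. Qed.

Lemma lmul_linv_cancel p q : lmul (linv p) (lmul p q) = q.
Proof. now rewrite lmul_assoc, lmul_linv_l, lmul_1_l. Qed.

Lemma lmul_linv_cancel_r p q : lmul p (lmul (linv p) q) = q.
Proof. now rewrite lmul_assoc, (lmul_comm p), lmul_linv_l, lmul_1_l. Qed.

Lemma lmul_inj p q r : lmul p q = lmul p r -> q = r.
Proof. intros E; now rewrite <- (lmul_linv_cancel p q), E, lmul_linv_cancel. Qed.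

Lemma lneg_lmul p q : lneg (lmul p q) = lmul (lneg p) q.
Proof. destruct p as [[|] m], q as [[|] n]; reflexivity. Qed.

Lemma lmul_lneg p q : lmul p (lneg q) = lmul (lneg p) q.
Proof. destruct p as [[|] m], q as [[|] n]; reflexivity. Qed.

Lemma lneg_lneg p : lneg (lneg p) = p.
Proof. destruct p as [[|] n]; reflexivity. Qed.

Lemma lval_lmul lam p q : lam <> 0 -> lval lam (lmul p q) = lval lam p * lval lam q.
Proof.
  intros H; unfold lval, lmul; simpl; rewrite powerRZ_add by exact H.
  destruct (fst p), (fst q); simpl; ring.
Qed.

Lemma lval_lneg lam p : lval lam (lneg p) = - lval lam p.
Proof. unfold lval, lneg; simpl; destruct (fst p); simpl; ring. Qed.

(** * Point masses and finite sums *)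

Definition delta (p k : Lam) : C := if Lam_eq_dec k p then RtoC 1 else RtoC 0.

Lemma delta_same p : delta p p = RtoC 1.
Proof. unfold delta; now destruct (Lam_eq_dec p p). Qed.

Lemma delta_diff p k : k <> p -> delta p k = RtoC 0.
Proof. unfold delta; now destruct (Lam_eq_dec k p). Qed.

Lemma delta_lmul x p k : delta (lmul x p) (lmul x k) = delta p k.
Proof.
  destruct (Lam_eq_dec k p) as [->|H]; [now rewrite !delta_same|].
  rewrite !delta_diff; auto; intros E; apply H, (lmul_inj x), E.
Qed.

(** Translation reduces every point mass to the one at [1], whose series is given by [sumZ_at0]. *)
Lemma delta_shift p k : delta p k = delta (lpow 0) (lmul (linv p) k).
Proof. now rewrite <- (delta_lmul (linv p)), lmul_linv_l. Qed.

Lemma abs_summable_delta p : abs_summable (delta p).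
Proof.
  replace (delta p) with (fun k => delta (lpow 0) (lmul (linv p) k))
    by (apply functional_extensionality; intros; now rewrite <- delta_shift).
  apply abs_summable_lmul, sumZ_at0; intros n Hn.
  rewrite !delta_diff, Cmod_0; [ring| |]; unfold lpow; congruence.
Qed.

Lemma sumLC_delta p : sumLC (delta p) = RtoC 1.
Proof.
  rewrite (sumLC_ext _ (fun k => delta (lpow 0) (lmul (linv p) k)) (delta_shift p)).
  rewrite sumLC_lmul by apply abs_summable_delta.
  unfold sumLC, sumL.
  rewrite !(fun u H => proj2 (sumZ_at0 u H)).
  - change (false, 0%Z) with (lpow 0); rewrite delta_same, delta_diff by discriminate.
    unfold RtoC; simpl; f_equal; ring.
  - intros n Hn; rewrite !delta_diff; [simpl; ring| |]; unfold lpow; congruence.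
  - intros n Hn; rewrite !delta_diff; [simpl; ring| |]; unfold lpow; congruence.
Qed.

Definition csum {X : Type} (l : list X) (F : X -> C) : C :=
  fold_right (fun x acc => Cplus (F x) acc) (RtoC 0) l.

Lemma csum_ext {X} (l : list X) (F G : X -> C) :
  (forall x, In x l -> F x = G x) -> csum l F = csum l G.
Proof.
  induction l as [|x l IH]; intros E; [reflexivity|]; simpl.
  rewrite (E x (or_introl eq_refl)), IH; [reflexivity|].
  intros; apply E; now right.
Qed.

Lemma csum_map {X Y} (h : X -> Y) (l : list X) (F : Y -> C) :
  csum (map h l) F = csum l (fun x => F (h x)).
Proof. induction l as [|x l IH]; [reflexivity|]; simpl; now rewrite IH. Qed.

Lemma csum_app {X} (l1 l2 : list X) (F : X -> C) :
  csum (l1 ++ l2) F = Cplus (csum l1 F) (csum l2 F).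
Proof. induction l1 as [|x l IH]; simpl; [|rewrite IH]; ring. Qed.

Lemma csum_scal {X} (c : C) (l : list X) (F : X -> C) :
  csum l (fun x => Cmult c (F x)) = Cmult c (csum l F).
Proof. induction l as [|x l IH]; simpl; [|rewrite IH]; ring. Qed.

Lemma csum_plus {X} (l : list X) (F G : X -> C) :
  csum l (fun x => Cplus (F x) (G x)) = Cplus (csum l F) (csum l G).
Proof. induction l as [|x l IH]; simpl; [|rewrite IH]; ring. Qed.

Lemma csum_conj {X} (l : list X) (F : X -> C) :
  csum l (fun x => Cconj (F x)) = Cconj (csum l F).
Proof.
  induction l as [|x l IH]; simpl; [|rewrite IH, Cplus_conj; reflexivity].
  apply injective_projections; simpl; ring.
Qed.

Lemma abs_summable_0 : abs_summable (fun _ => RtoC 0).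
Proof.
  apply (abs_summable_le _ (fun k => 0 * Cmod (delta (lpow 0) k))).
  - intros; rewrite Cmod_0; lra.
  - apply exL_scal, (abs_summable_delta (lpow 0)).
Qed.

Lemma sumLC_0 : sumLC (fun _ => RtoC 0) = RtoC 0.
Proof.
  rewrite (sumLC_ext _ (fun k => Cmult (RtoC 0) (delta (lpow 0) k))) by (intros; ring).
  rewrite sumLC_scal by apply abs_summable_delta; ring.
Qed.

Lemma abs_summable_csum {X} (l : list X) (F : X -> Lam -> C) :
  (forall x, In x l -> abs_summable (F x)) -> abs_summable (fun k => csum l (fun x => F x k)).
Proof.
  induction l as [|x l IH]; intros H; simpl; [apply abs_summable_0|].
  apply abs_summable_plus; [|apply IH]; intros; apply H; simpl; auto.
Qed.

Lemma sumLC_csum {X} (l : list X) (F : X -> Lam -> C) :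
  (forall x, In x l -> abs_summable (F x)) ->
  sumLC (fun k => csum l (fun x => F x k)) = csum l (fun x => sumLC (F x)).
Proof.
  induction l as [|x l IH]; intros H; simpl; [apply sumLC_0|].
  rewrite sumLC_plus, IH; try reflexivity.
  - intros; apply H; now right.
  - apply H; now left.
  - apply abs_summable_csum; intros; apply H; now right.
Qed.

(** Such an [f] is a finite combination of point masses, each of sum [1]. *)
Lemma sumLC_finite (l : list Lam) (f : Lam -> C) : NoDup l ->
  (forall k, ~ In k l -> f k = RtoC 0) -> sumLC f = csum l f.
Proof.
  intros Hl Hf.
  rewrite (sumLC_ext f (fun k => csum l (fun p => Cmult (f p) (delta p k)))).
  - rewrite sumLC_csum by (intros; apply abs_summable_scal, abs_summable_delta).
    apply csum_ext; intros p _.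
    rewrite sumLC_scal, sumLC_delta by apply abs_summable_delta; ring.
  - intros k; destruct (in_dec Lam_eq_dec k l) as [H|H].
    + clear Hf; induction l as [|p l IH]; [easy|]; inversion_clear Hl; simpl.
      destruct (Lam_eq_dec p k) as [->|Hpk].
      * rewrite delta_same, (csum_ext l _ (fun p => Cmult (RtoC 0) (f p))), csum_scal; [ring|].
        intros p Hp; rewrite delta_diff by congruence; ring.
      * rewrite delta_diff, <- IH by (auto; destruct H; congruence); ring.
    + rewrite Hf by exact H; symmetry.
      rewrite (csum_ext l _ (fun p => Cmult (RtoC 0) (f p))), csum_scal; [ring|].
      intros p Hp; rewrite delta_diff by congruence; ring.
Qed.

Lemma sumLC_single p (f : Lam -> C) :
  (forall k, k <> p -> f k = RtoC 0) -> sumLC f = f p.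
Proof.
  intros H; rewrite (sumLC_finite (p :: nil)); [simpl; ring | now repeat constructor|].
  intros k Hk; apply H; intros ->; apply Hk; now left.
Qed.

(** * Products given by stable sets of solutions *)

(** It agrees with [inner] when the second argument satisfies the reality condition. Being symmetric
    and complex linear in both arguments, it lets associativity in average pass to complex
    functions. *)
Definition bil (f g : Lam -> C) : C := sumLC (fun k => Cmult (f k) (g (lneg k))).

Lemma inner_bil f h : inA h -> inner f h = bil f h.
Proof. intros [_ H]; apply sumLC_ext; intros k; now rewrite H. Qed.

Lemma abs_summable_bil f g : abs_summable f -> abs_summable g ->
  abs_summable (fun k => Cmult (f k) (g (lneg k))).
Proof. intros; apply abs_summable_mult; [|apply abs_summable_lneg]; assumption. Qed.

Lemma bil_lin_l c f f' g : abs_summable f -> abs_summable f' -> abs_summable g ->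
  bil (fun k => Cplus (Cmult c (f k)) (f' k)) g = Cplus (Cmult c (bil f g)) (bil f' g).
Proof.
  intros Hf Hf' Hg; unfold bil.
  rewrite <- sumLC_scal, <- sumLC_plus by auto using abs_summable_bil, abs_summable_scal.
  apply sumLC_ext; intros; ring.
Qed.

Lemma bil_comm f g : abs_summable f -> abs_summable g -> bil f g = bil g f.
Proof.
  intros Hf Hg; unfold bil.
  rewrite <- (sumLC_lneg (fun k => Cmult (g k) (f (lneg k)))) by auto using abs_summable_bil.
  apply sumLC_ext; intros; rewrite lneg_lneg; ring.
Qed.

Lemma bil_lin_r c f g g' : abs_summable f -> abs_summable g -> abs_summable g' ->
  bil f (fun k => Cplus (Cmult c (g k)) (g' k)) = Cplus (Cmult c (bil f g)) (bil f g').
Proof.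
  intros Hf Hg Hg'.
  rewrite bil_comm by auto using abs_summable_plus, abs_summable_scal.
  now rewrite bil_lin_l, (bil_comm g), (bil_comm g').
Qed.

Lemma inA_summable f : inA f -> abs_summable f.
Proof. now intros [H _]. Qed.

Lemma inA_lmul x f : inA f -> inA (fun k => f (lmul x k)).
Proof.
  intros [H1 H2]; split; [now apply abs_summable_lmul|].
  intros k; now rewrite lmul_lneg, <- lneg_lmul, H2.
Qed.

Lemma inA_lneg f : inA f -> inA (fun k => f (lneg k)).
Proof. exact (inA_lmul (true, 0%Z) f). Qed.

Lemma inA_mult f g : inA f -> inA g -> inA (fun k => Cmult (f k) (g k)).
Proof.
  intros [H1 H2] [H3 H4]; split; [now apply abs_summable_mult|].
  intros k; now rewrite H2, H4, Cmult_conj.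
Qed.

Lemma Cconj_RtoC (r : R) : Cconj (RtoC r) = RtoC r.
Proof. apply injective_projections; simpl; ring. Qed.

Lemma inA_lin (r : R) f g : inA f -> inA g ->
  inA (fun k => Cplus (Cmult (RtoC r) (f k)) (g k)).
Proof.
  intros [H1 H2] [H3 H4]; split.
  - auto using abs_summable_plus, abs_summable_scal.
  - intros k; now rewrite H2, H4, Cplus_conj, Cmult_conj, Cconj_RtoC.
Qed.

Lemma inA_0 : inA (fun _ => RtoC 0).
Proof. split; [apply abs_summable_0 | intros; now rewrite Cconj_RtoC]. Qed.

Lemma inA_scal (r : R) f : inA f -> inA (fun k => Cmult (RtoC r) (f k)).
Proof.
  intros Hf; generalize (inA_lin r f _ Hf inA_0).
  match goal with |- inA ?x -> inA ?y => replace y with x; [easy|] end.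
  apply functional_extensionality; intros; ring.
Qed.

Lemma inA_csum {X} (l : list X) (F : X -> Lam -> C) :
  (forall x, In x l -> inA (F x)) -> inA (fun k => csum l (fun x => F x k)).
Proof.
  intros H; split; [apply abs_summable_csum; intros; now apply H|].
  intros k; rewrite <- csum_conj; apply csum_ext; intros x Hx; now apply H.
Qed.

Lemma is_product_ext lam (op op' : binop) :
  (forall f g, inA f -> inA g -> forall k, op f g k = op' f g k) ->
  is_product lam op' -> is_product lam op.
Proof.
  intros E H.
  assert (E' : forall f g, inA f -> inA g -> op f g = op' f g).
  { intros f g Hf Hg; apply functional_extensionality; now apply E. }
  destruct H as (P0 & P1 & P2 & P3 & P4 & P5 & S1 & S2).
  refine (conj _ (conj _ (conj _ (conj _ (conj _ (conj _ (conj _ _))))))).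
  - intros f g Hf Hg; rewrite E' by assumption; now apply P0.
  - intros f g Hf Hg k; rewrite !E by assumption; now apply P1.
  - intros f g h gam Hf Hg Hh k; rewrite !E; try assumption; [now apply P2|].
    replace (fun x => Cplus (f x) (Cmult (RtoC gam) (g x)))
      with (fun x => Cplus (Cmult (RtoC gam) (g x)) (f x))
      by (apply functional_extensionality; intros; ring).
    now apply inA_lin.
  - intros f g Hf Hg k; rewrite !E by assumption; now apply P3.
  - intros f g h Hf Hg Hh; rewrite !E' by assumption; now apply P4.
  - intros f g Hf Hg Hf' Hg' k; rewrite (E' f g), !E by assumption; now apply P5.
  - intros n f g Hf Hg k; rewrite (E' f g), !E;
      try (now apply S1); try assumption; now apply (inA_lmul (lpow n)).
  - intros f g Hf Hg k; rewrite !E; try (now apply S2); try assumption; now apply inA_lneg.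
Qed.

Lemma is_product_lin lam (c1 c2 : R) (op1 op2 : binop) :
  is_product lam op1 -> is_product lam op2 ->
  is_product lam (fun f g k =>
    Cplus (Cmult (RtoC c1) (op1 f g k)) (Cmult (RtoC c2) (op2 f g k))).
Proof.
  intros (P0 & P1 & P2 & P3 & P4 & P5 & S1 & S2) (Q0 & Q1 & Q2 & Q3 & Q4 & Q5 & R1 & R2).
  assert (A : forall f g, inA f -> inA g -> inA (fun k =>
    Cplus (Cmult (RtoC c1) (op1 f g k)) (Cmult (RtoC c2) (op2 f g k)))).
  { intros f g Hf Hg; apply inA_lin; [now apply P0 | apply inA_scal; now apply Q0]. }
  refine (conj _ (conj _ (conj _ (conj _ (conj _ (conj _ (conj _ _))))))).
  - exact A.
  - intros f g Hf Hg; now apply A.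
  - intros f g h gam Hf Hg Hh k; rewrite P2, Q2 by assumption; ring.
  - intros f g Hf Hg k; now rewrite P3, Q3.
  - intros f g h Hf Hg Hh.
    assert (H1 := P4 f g h Hf Hg Hh); assert (H2 := Q4 f g h Hf Hg Hh).
    rewrite !inner_bil in * by auto.
    assert (Z := inA_summable _ inA_0).
    (* A zero summand gives the combinations the shape [c f + f'] required by [bil_lin_l] and
       [bil_lin_r]. *)
    replace (fun k => Cplus (Cmult (RtoC c1) (op1 f g k)) (Cmult (RtoC c2) (op2 f g k)))
      with (fun k => Cplus (Cmult (RtoC c1) (op1 f g k))
        ((fun k => Cplus (Cmult (RtoC c2) (op2 f g k)) (RtoC 0)) k))
      by (apply functional_extensionality; intros; ring).
    replace (fun k => Cplus (Cmult (RtoC c1) (op1 g h k)) (Cmult (RtoC c2) (op2 g h k)))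
      with (fun k => Cplus (Cmult (RtoC c1) (op1 g h k))
        ((fun k => Cplus (Cmult (RtoC c2) (op2 g h k)) (RtoC 0)) k))
      by (apply functional_extensionality; intros; ring).
    assert (S1' := inA_summable _ (P0 f g Hf Hg)); assert (S2' := inA_summable _ (Q0 f g Hf Hg)).
    assert (S3' := inA_summable _ (P0 g h Hg Hh)); assert (S4' := inA_summable _ (Q0 g h Hg Hh)).
    assert (Sf := inA_summable _ Hf); assert (Sh := inA_summable _ Hh).
    rewrite !bil_lin_l, !bil_lin_r, H1, H2 by auto using abs_summable_plus, abs_summable_scal.
    f_equal; f_equal; unfold bil; rewrite (sumLC_ext _ (fun _ => RtoC 0));
      [|intros; ring]; symmetry; rewrite (sumLC_ext _ (fun _ => RtoC 0)); auto; intros; ring.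
  - intros f g Hf Hg Hf' Hg' k; specialize (P5 f g Hf Hg Hf' Hg' k).
    specialize (Q5 f g Hf Hg Hf' Hg' k);
    unfold lderiv at 1 in P5; unfold lderiv at 1 in Q5; unfold lderiv at 1.
    transitivity (Cplus
      (Cmult (RtoC c1) (Cmult (Cmult Ci (RtoC (lval lam k))) (op1 f g k)))
      (Cmult (RtoC c2) (Cmult (Cmult Ci (RtoC (lval lam k))) (op2 f g k)))); [ring|].
    rewrite P5, Q5; ring.
  - intros n f g Hf Hg k; rewrite <- S1, <- R1 by assumption; reflexivity.
  - intros f g Hf Hg k; now rewrite S2, R2.
Qed.

Definition swap (pq : Lam * Lam) : Lam * Lam := (snd pq, fst pq).

(* [p + q = 1] is equivalent to [- q / p + 1 / p = 1]; together with [swap] this generates an action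
   of the symmetric group of order 6 on the solutions. *)
Definition rot (pq : Lam * Lam) : Lam * Lam :=
  (lmul (lneg (snd pq)) (linv (fst pq)), linv (fst pq)).

(** Substitute [k / p] for [k] in the sum. This is how associativity in average comes to act on
    pairs by [rot]. *)
Lemma bil_mono p q f g h : abs_summable f -> abs_summable g -> abs_summable h ->
  bil (fun k => Cmult (f (lmul p k)) (g (lmul q k))) h =
  bil f (fun k => Cmult (g (lmul (fst (rot (p, q))) k)) (h (lmul (snd (rot (p, q))) k))).
Proof.
  intros Hf Hg Hh; unfold bil; simpl.
  rewrite <- (sumLC_lmul (linv p)).
  2: { apply abs_summable_bil; [apply abs_summable_mult|]; auto using abs_summable_lmul. }
  apply sumLC_ext; intros k.
  rewrite lmul_linv_cancel_r, !lmul_lneg, !lneg_lmul, lneg_lneg, !lmul_assoc; ring.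
Qed.

(** The equation [p + q = 1] yields the Leibniz rule, invariance under [swap] commutativity, and
    invariance under [rot] associativity in average. Invariance is expressed through sums, so lists
    with repetitions are covered. *)
Lemma is_product_sum_pairs lam (T : list (Lam * Lam)) : lam <> 0 ->
  (forall pq, In pq T -> lval lam (fst pq) + lval lam (snd pq) = 1) ->
  (forall F, csum T (fun pq => F (swap pq)) = csum T F) ->
  (forall F, csum T (fun pq => F (rot pq)) = csum T F) ->
  is_product lam (sum_pairs T).
Proof.
  intros Hlam HT Hswap Hrot.
  set (M := fun (f g : Lam -> C) (pq : Lam * Lam) (k : Lam) =>
    Cmult (f (lmul (fst pq) k)) (g (lmul (snd pq) k))).
  change (sum_pairs T) with (fun f g k => csum T (fun pq => M f g pq k)).
  assert (A : forall f g, inA f -> inA g -> inA (fun k => csum T (fun pq => M f g pq k))).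
  { intros f g Hf Hg; apply inA_csum; intros pq _; apply inA_mult; now apply inA_lmul. }
  assert (SM : forall f g pq, inA f -> inA g -> abs_summable (M f g pq)).
  { intros f g pq [Hf _] [Hg _]; apply abs_summable_mult; now apply abs_summable_lmul. }
  refine (conj _ (conj _ (conj _ (conj _ (conj _ (conj _ (conj _ _))))))).
  - exact A.
  - intros f g Hf Hg; now apply A.
  - intros f g h gam _ _ _ k; rewrite <- csum_scal, <- csum_plus.
    apply csum_ext; intros pq _; unfold M; ring.
  - intros f g _ _ k; rewrite <- Hswap; apply csum_ext; intros [p q] _.
    unfold M; simpl; ring.
  - intros f g h Hf Hg Hh; rewrite !inner_bil by auto.
    transitivity (csum T (fun pq => bil (M f g pq) h)).
    { unfold bil; rewrite <- sumLC_csum.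
      - apply sumLC_ext; intros k; rewrite Cmult_comm, <- csum_scal.
        apply csum_ext; intros; ring.
      - intros pq _; apply (abs_summable_bil (M f g pq)); [now apply SM | apply Hh]. }
    transitivity (csum T (fun pq => bil f (M g h pq))).
    { rewrite <- (Hrot (fun pq => bil f (M g h pq))); apply csum_ext; intros [p q] _.
      apply bil_mono; now apply inA_summable. }
    unfold bil; rewrite <- sumLC_csum.
    + apply sumLC_ext; intros k; now rewrite <- csum_scal.
    + intros pq _; apply abs_summable_bil; [apply Hf | now apply SM].
  - intros f g _ _ _ _ k; rewrite <- csum_plus; unfold lderiv at 1; rewrite <- csum_scal.
    apply csum_ext; intros pq Hpq; unfold M, lderiv.
    rewrite !lval_lmul, !RtoC_mult by exact Hlam.
    (* The Leibniz rule reads [k = p k + q k]: a factor [1] is inserted on the left and replaced by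
       [p + q]. *)
    assert (E : Cplus (RtoC (lval lam (fst pq))) (RtoC (lval lam (snd pq))) = RtoC 1)
      by (rewrite <- RtoC_plus, HT by exact Hpq; reflexivity).
    match goal with |- ?x = _ => transitivity (Cmult (RtoC 1) x); [ring|] end.
    rewrite <- E; ring.
  - intros n f g _ _ k; apply csum_ext; intros pq _; unfold M, dilate.
    now rewrite !lmul_assoc, (lmul_comm (lpow n) (fst pq)), (lmul_comm (lpow n) (snd pq)).
  - intros f g _ _ k; apply csum_ext; intros pq _; unfold M.
    now rewrite !lmul_lneg, !lneg_lmul.
Qed.

(** * Expansion of an arbitrary product *)

(** [rpart] and [ipart] are the real and imaginary parts for the conjugation that sends [f] to
    [k |-> Cconj (f (lneg k))]; its fixed points are the functions with the reality condition. *)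
Definition rpart (f : Lam -> C) (k : Lam) : C :=
  Cmult (RtoC (/ 2)) (Cplus (f k) (Cconj (f (lneg k)))).

Definition ipart (f : Lam -> C) (k : Lam) : C :=
  Cmult (Cmult (RtoC (- / 2)) Ci) (Cminus (f k) (Cconj (f (lneg k)))).

Lemma rpart_ipart f k : f k = Cplus (Cmult Ci (ipart f k)) (rpart f k).
Proof. unfold rpart, ipart; apply injective_projections; simpl; field. Qed.

Lemma rpart_inA f : abs_summable f -> inA (rpart f).
Proof.
  intros Hf; split.
  - apply abs_summable_scal, abs_summable_plus; [exact Hf|].
    apply abs_summable_conj, abs_summable_lneg, Hf.
  - intros k; unfold rpart; rewrite lneg_lneg; apply injective_projections; simpl; ring.
Qed.

Lemma ipart_inA f : abs_summable f -> inA (ipart f).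
Proof.
  intros Hf; split.
  - apply abs_summable_scal, (abs_summable_plus f (fun k => Copp (Cconj (f (lneg k))))); [exact Hf|].
    replace (fun k => Copp (Cconj (f (lneg k))))
      with (fun k => Cmult (RtoC (-1)) (Cconj (f (lneg k)))).
    + apply abs_summable_scal, abs_summable_conj, abs_summable_lneg, Hf.
    + apply functional_extensionality; intros; apply injective_projections; simpl; ring.
  - intros k; unfold ipart; rewrite lneg_lneg; apply injective_projections; simpl; ring.
Qed.

Lemma rpart_id f : inA f -> rpart f = f.
Proof.
  intros [_ H]; apply functional_extensionality; intros k; unfold rpart; rewrite H.
  apply injective_projections; simpl; field.
Qed.

Lemma ipart_0 f : inA f -> ipart f = fun _ => RtoC 0.
Proof.
  intros [_ H]; apply functional_extensionality; intros k; unfold ipart; rewrite H.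
  apply injective_projections; simpl; ring.
Qed.

Section Completeness.
Variables (lam : R) (op : binop).
Hypothesis Hop : is_product lam op.

Lemma op_inA f g : inA f -> inA g -> inA (op f g).
Proof. apply Hop. Qed.

Lemma op_comm f g k : inA f -> inA g -> op f g k = op g f k.
Proof. intros; now apply Hop. Qed.

Lemma op_0_l h k : inA h -> op (fun _ => RtoC 0) h k = RtoC 0.
Proof.
  intros Hh; destruct Hop as (_ & _ & P2 & _).
  (* From [0 = 0 + 1 * 0] the value [x] in question satisfies [x = x + x]. *)
  assert (E := P2 _ _ h 1 inA_0 inA_0 Hh k); cbv beta in E.
  replace (fun x : Lam => Cplus (RtoC 0) (Cmult (RtoC 1) (RtoC 0)))
    with (fun _ : Lam => RtoC 0) in E by (apply functional_extensionality; intros; ring).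
  revert E; generalize (op (fun _ => RtoC 0) h k); intros [x y] E.
  assert (E1 := f_equal fst E); assert (E2 := f_equal snd E); simpl in E1, E2.
  apply injective_projections; simpl; lra.
Qed.

Lemma op_lin_l (r : R) f g h k : inA f -> inA g -> inA h ->
  op (fun x => Cplus (Cmult (RtoC r) (f x)) (g x)) h k
  = Cplus (Cmult (RtoC r) (op f h k)) (op g h k).
Proof.
  intros Hf Hg Hh; destruct Hop as (_ & _ & P2 & _).
  rewrite Cplus_comm, <- P2 by assumption.
  f_equal; apply functional_extensionality; intros; ring.
Qed.

(* The complex bilinear extension of [op] to functions without the reality condition, such as
   [delta p]. *)
Definition Cop (f g : Lam -> C) (k : Lam) : C :=
  Cplus (Cmult Ci (Cplus (Cmult (RtoC 1) (op (ipart f) (rpart g) k)) (op (rpart f) (ipart g) k)))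
        (Cplus (Cmult (RtoC (-1)) (op (ipart f) (ipart g) k)) (op (rpart f) (rpart g) k)).

Lemma Cop_op f g k : inA f -> inA g -> Cop f g k = op f g k.
Proof.
  intros Hf Hg; unfold Cop; rewrite !rpart_id, !ipart_0 by assumption.
  rewrite (op_comm f (fun _ => RtoC 0)), !op_0_l by auto using inA_0; ring.
Qed.

Lemma Cop_comm f g k : abs_summable f -> abs_summable g -> Cop f g k = Cop g f k.
Proof.
  intros Hf Hg; unfold Cop.
  rewrite (op_comm (rpart g)), (op_comm (ipart g)), (op_comm (ipart g)), (op_comm (rpart g))
    by auto using rpart_inA, ipart_inA; ring.
Qed.

Lemma Cop_summable f g : abs_summable f -> abs_summable g -> abs_summable (Cop f g).
Proof.
  intros Hf Hg; unfold Cop.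
  repeat first [apply abs_summable_plus | apply abs_summable_scal];
    apply inA_summable, op_inA; auto using rpart_inA, ipart_inA.
Qed.

Lemma Cop_scal_l c f g k : abs_summable f -> abs_summable g ->
  Cop (fun x => Cmult c (f x)) g k = Cmult c (Cop f g k).
Proof.
  intros Hf Hg; unfold Cop.
  replace (rpart (fun x => Cmult c (f x)))
    with (fun x => Cplus (Cmult (RtoC (fst c)) (rpart f x)) (Cmult (RtoC (- snd c)) (ipart f x)))
    by (apply functional_extensionality; intros; unfold rpart, ipart;
        apply injective_projections; simpl; field).
  replace (ipart (fun x => Cmult c (f x)))
    with (fun x => Cplus (Cmult (RtoC (fst c)) (ipart f x)) (Cmult (RtoC (snd c)) (rpart f x)))
    by (apply functional_extensionality; intros; unfold rpart, ipart;
        apply injective_projections; simpl; field).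
  assert (Hr := rpart_inA _ Hf); assert (Hi := ipart_inA _ Hf).
  assert (Hr' := rpart_inA _ Hg); assert (Hi' := ipart_inA _ Hg).
  assert (L : forall (r : R) u h, inA u -> inA h ->
    op (fun x => Cmult (RtoC r) (u x)) h k = Cmult (RtoC r) (op u h k)).
  { intros r u h Hu Hh; rewrite <- (Cplus_0_r (Cmult _ _)), <- (op_0_l h k) by exact Hh.
    rewrite <- op_lin_l by auto using inA_0.
    f_equal; apply functional_extensionality; intros; ring. }
  rewrite !op_lin_l, !L by auto using inA_scal.
  apply injective_projections; simpl; ring.
Qed.

Lemma Cop_assoc f g h : abs_summable f -> abs_summable g -> abs_summable h ->
  bil (Cop f g) h = bil f (Cop g h).
Proof.
  intros Hf Hg Hh.
  assert (A : forall u v w, inA u -> inA v -> inA w -> bil (op u v) w = bil u (op v w)).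
  { intros u v w Hu Hv Hw; rewrite <- !inner_bil by auto using op_inA.
    destruct Hop as (_ & _ & _ & _ & P4 & _); now apply P4. }
  assert (Hr := rpart_inA _ Hf); assert (Hi := ipart_inA _ Hf).
  assert (Hr' := rpart_inA _ Hg); assert (Hi' := ipart_inA _ Hg).
  assert (Hr'' := rpart_inA _ Hh); assert (Hi'' := ipart_inA _ Hh).
  transitivity (bil (Cop f g) (fun k => Cplus (Cmult Ci (ipart h k)) (rpart h k))).
  { f_equal; apply functional_extensionality, rpart_ipart. }
  transitivity (bil (fun k => Cplus (Cmult Ci (ipart f k)) (rpart f k)) (Cop g h)).
  2: { f_equal; apply functional_extensionality; intros; symmetry; apply rpart_ipart. }
  unfold Cop.
  (* The coefficient [RtoC 1] in [Cop] gives each of its sums the shape [c f + f'] that these lemmas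
     expect. *)
  repeat (first [rewrite bil_lin_l | rewrite bil_lin_r];
    [| auto 8 using inA_summable, op_inA, abs_summable_plus, abs_summable_scal ..]).
  rewrite !A by assumption.
  repeat match goal with |- context [bil ?x ?y] => generalize (bil x y); intro end.
  apply injective_projections; simpl; ring.
Qed.

Lemma lderiv_Cop f g k : abs_summable f -> abs_summable g ->
  abs_summable (lderiv lam f) -> abs_summable (lderiv lam g) ->
  lderiv lam (Cop f g) k = Cplus (Cop (lderiv lam f) g k) (Cop f (lderiv lam g) k).
Proof.
  intros Hf Hg Hf' Hg'.
  assert (Dr : forall u, rpart (lderiv lam u) = lderiv lam (rpart u)).
  { intros u; apply functional_extensionality; intros x; unfold rpart, lderiv.
    rewrite lval_lneg; apply injective_projections; simpl; ring. }
  assert (Di : forall u, ipart (lderiv lam u) = lderiv lam (ipart u)).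
  { intros u; apply functional_extensionality; intros x; unfold ipart, lderiv.
    rewrite lval_lneg; apply injective_projections; simpl; ring. }
  assert (L : forall u v, inA u -> inA v -> inA (lderiv lam u) -> inA (lderiv lam v) ->
    Cmult (Cmult Ci (RtoC (lval lam k))) (op u v k)
    = Cplus (op (lderiv lam u) v k) (op u (lderiv lam v) k)).
  { intros u v; destruct Hop as (_ & _ & _ & _ & _ & P5 & _); intros; now apply P5. }
  assert (Hr := rpart_inA _ Hf); assert (Hi := ipart_inA _ Hf).
  assert (Hr' := rpart_inA _ Hg); assert (Hi' := ipart_inA _ Hg).
  assert (Kr := rpart_inA _ Hf'); assert (Ki := ipart_inA _ Hf').
  assert (Kr' := rpart_inA _ Hg'); assert (Ki' := ipart_inA _ Hg').
  unfold Cop; rewrite !Dr, !Di in *; unfold lderiv at 1.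
  match goal with |- Cmult ?z (Cplus (Cmult Ci (Cplus (Cmult ?r ?a) ?b)) (Cplus (Cmult ?s ?c) ?d)) = _ =>
    transitivity (Cplus (Cmult Ci (Cplus (Cmult r (Cmult z a)) (Cmult z b)))
                        (Cplus (Cmult s (Cmult z c)) (Cmult z d))); [ring|] end.
  rewrite !L by assumption; ring.
Qed.

Lemma Cop_lmul x f g k : abs_summable f -> abs_summable g ->
  Cop f g (lmul x k) = Cop (fun y => f (lmul x y)) (fun y => g (lmul x y)) k.
Proof.
  intros Hf Hg; destruct Hop as (_ & _ & _ & _ & _ & _ & S1 & S2).
  assert (L : forall u v, inA u -> inA v ->
    op u v (lmul x k) = op (fun y => u (lmul x y)) (fun y => v (lmul x y)) k).
  { intros u v Hu Hv; destruct x as [[|] n]; [|now apply (S1 n)].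
    (* For a negative [x], scaling handles the absolute value and parity the sign. *)
    replace (lmul (true, n) k) with (lmul (lpow n) (lneg k))
      by (destruct k as [[|] j]; reflexivity).
    fold (dilate (lpow n) (op u v) (lneg k)).
    rewrite S1, S2 by (try assumption; now apply inA_lmul).
    f_equal; apply functional_extensionality; intros [[|] j]; reflexivity. }
  assert (Dr : forall u, rpart (fun y => u (lmul x y)) = fun y => rpart u (lmul x y)).
  { intros u; apply functional_extensionality; intros y; unfold rpart.
    now rewrite lmul_lneg, lneg_lmul. }
  assert (Di : forall u, ipart (fun y => u (lmul x y)) = fun y => ipart u (lmul x y)).
  { intros u; apply functional_extensionality; intros y; unfold ipart.
    now rewrite lmul_lneg, lneg_lmul. }
  unfold Cop; rewrite !Dr, !Di, !L by auto using rpart_inA, ipart_inA; reflexivity.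
Qed.

(** This is the complex form of the reality property: the conjugation fixes [rpart] and changes the
    sign of [ipart]. *)
Lemma Cop_conj f g k : abs_summable f -> abs_summable g ->
  Cconj (Cop f g (lneg k)) = Cop (fun y => Cconj (f (lneg y))) (fun y => Cconj (g (lneg y))) k.
Proof.
  intros Hf Hg.
  assert (Hr := rpart_inA _ Hf); assert (Hi := ipart_inA _ Hf).
  assert (Hr' := rpart_inA _ Hg); assert (Hi' := ipart_inA _ Hg).
  assert (Dr : forall u, rpart (fun y => Cconj (u (lneg y))) = rpart u).
  { intros u; apply functional_extensionality; intros y; unfold rpart.
    rewrite lneg_lneg; apply injective_projections; simpl; ring. }
  assert (Di : forall u, ipart (fun y => Cconj (u (lneg y)))
    = fun y => Cplus (Cmult (RtoC (-1)) (ipart u y)) (RtoC 0)).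
  { intros u; apply functional_extensionality; intros y; unfold ipart.
    rewrite lneg_lneg; apply injective_projections; simpl; ring. }
  assert (N : forall u v, inA u -> inA v ->
    op (fun y => Cplus (Cmult (RtoC (-1)) (u y)) (RtoC 0)) v k = Cmult (RtoC (-1)) (op u v k)).
  { intros u v Hu Hv; rewrite op_lin_l, op_0_l by auto using inA_0; ring. }
  assert (NA : forall u, inA u -> inA (fun y => Cplus (Cmult (RtoC (-1)) (u y)) (RtoC 0))).
  { intros u Hu; apply inA_lin; auto using inA_0. }
  assert (P1 : forall u v, inA u -> inA v -> op u v (lneg k) = Cconj (op u v k)).
  { intros; now apply Hop. }
  unfold Cop; rewrite !Dr, !Di, !P1 by assumption.
  rewrite (op_comm (rpart f) (fun y => Cplus _ _)), !N by auto.
  rewrite (op_comm (ipart f) (fun y => Cplus _ _)), !N, (op_comm (ipart g)), (op_comm (ipart g)) by auto.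
  apply injective_projections; simpl; ring.
Qed.

(** * The coefficients of a product *)

Definition coef (p q r : Lam) : C := Cop (delta p) (delta q) r.

Lemma coef_comm p q r : coef p q r = coef q p r.
Proof. apply Cop_comm; apply abs_summable_delta. Qed.

Lemma coef_lmul x p q r : coef (lmul x p) (lmul x q) (lmul x r) = coef p q r.
Proof.
  unfold coef; rewrite Cop_lmul by apply abs_summable_delta.
  f_equal; apply functional_extensionality; intros; apply delta_lmul.
Qed.

Lemma bil_delta_r f p : bil f (delta p) = f (lneg p).
Proof.
  unfold bil; rewrite (sumLC_single (lneg p)); [rewrite lneg_lneg, delta_same; ring|].
  intros k Hk; rewrite delta_diff; [ring|]; intros E; apply Hk; now rewrite <- E, lneg_lneg.
Qed.

(** Both sides equal [bil (Cop (delta p) (delta q)) (delta r)]. With [coef_comm] this makes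
    [coef p q (lneg r)] symmetric in its three arguments. *)
Lemma coef_assoc p q r : coef p q (lneg r) = coef q r (lneg p).
Proof.
  assert (H := abs_summable_delta); unfold coef at 1.
  rewrite <- bil_delta_r, Cop_assoc, bil_comm, bil_delta_r by auto using Cop_summable.
  reflexivity.
Qed.

(** [delta p] is an eigenvector of the derivative with eigenvalue [i p], so the Leibniz rule reads
    [(r - p - q) coef p q r = 0]. *)
Lemma coef_support p q r : coef p q r <> RtoC 0 -> lval lam p + lval lam q = lval lam r.
Proof.
  assert (D : forall p, lderiv lam (delta p) = fun k => Cmult (Cmult Ci (RtoC (lval lam p))) (delta p k)).
  { intros s; apply functional_extensionality; intros k; unfold lderiv.
    destruct (Lam_eq_dec k s) as [->|H]; [reflexivity|].
    rewrite delta_diff by exact H; ring. }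
  assert (H := abs_summable_delta).
  intros H0; assert (E := lderiv_Cop (delta p) (delta q) r (H _) (H _)).
  rewrite !D in E; specialize (E (abs_summable_scal _ _ (H _)) (abs_summable_scal _ _ (H _))).
  rewrite Cop_scal_l, (Cop_comm (delta p) (fun k => Cmult _ _)), Cop_scal_l,
    (Cop_comm (delta q) (delta p)) in E by auto using abs_summable_scal.
  unfold lderiv in E; fold (coef p q r) in E.
  assert (E' : Cmult (RtoC (lval lam r - (lval lam p + lval lam q))) (coef p q r) = RtoC 0).
  { transitivity (Cmult (Copp Ci) (Cminus (Cmult (Cmult Ci (RtoC (lval lam r))) (coef p q r))
       (Cplus (Cmult (Cmult Ci (RtoC (lval lam p))) (coef p q r))
              (Cmult (Cmult Ci (RtoC (lval lam q))) (coef p q r))))).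
    - apply injective_projections; simpl; ring.
    - rewrite E; ring. }
  destruct (Req_dec (lval lam r - (lval lam p + lval lam q)) 0) as [Z|Z]; [lra|].
  exfalso; apply Cmult_neq_0 in E'; auto.
  intros Z'; apply Z; exact (f_equal fst Z').
Qed.

(** Reality relates the conjugate to the coefficient at [(-p, -q, -r)], and parity removes the three
    signs. *)
Lemma coef_real p q r : exists c : R, coef p q r = RtoC c.
Proof.
  assert (E : Cconj (coef p q r) = coef p q r).
  { unfold coef at 1; rewrite <- (lneg_lneg r), Cop_conj by apply abs_summable_delta.
    change (lneg (lneg r)) with (lmul (true, 0%Z) (lneg r)); unfold coef.
    rewrite Cop_lmul by apply abs_summable_delta.
    f_equal; apply functional_extensionality; intros y;
      change (lmul (true, 0%Z) y) with (lneg y); unfold delta;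
      destruct Lam_eq_dec; apply Cconj_RtoC. }
  exists (fst (coef p q r)); apply (f_equal snd) in E; simpl in E.
  apply injective_projections; simpl; lra.
Qed.

(** Scaling by [-p] turns the triple [(-q/p, 1/p, 1)] into [(q, -1, -p)], which [coef_assoc] links
    to [(p, q, 1)]. *)
Lemma coef_rot p q : coef (fst (rot (p, q))) (snd (rot (p, q))) (lpow 0) = coef p q (lpow 0).
Proof.
  rewrite <- (coef_lmul (lneg p)), coef_comm; simpl.
  replace (lpow 0) with (lneg (true, 0%Z)) at 2 by reflexivity.
  rewrite coef_assoc, (coef_comm q); f_equal.
  - destruct p as [[|] m]; unfold lmul, lneg, linv; simpl; f_equal; lia.
  - destruct p as [[|] m], q as [[|] n]; unfold lmul, lneg, linv; simpl; f_equal; lia.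
  - destruct p as [[|] m]; unfold lmul, lneg, linv; simpl; f_equal; lia.
Qed.

(** The value at [1] is the pairing with [delta (-1)]. Associativity first frees [f], leaving the
    values of the product of [g] and [delta (-1)]; each is a pairing with a point mass, and
    associativity then frees [g]. Infinite sums enter only through [bil]. *)
Lemma Cop_expansion f g : abs_summable f -> abs_summable g ->
  Cop f g (lpow 0) = sumLC (fun p => sumLC (fun q =>
    Cmult (coef p q (lpow 0)) (Cmult (f p) (g q)))).
Proof.
  intros Hf Hg; assert (H := abs_summable_delta).
  change (lpow 0) with (lneg (true, 0%Z)) at 1.
  rewrite <- bil_delta_r, Cop_assoc by auto.
  unfold bil; apply sumLC_ext; intros p.
  rewrite Cop_comm, <- bil_delta_r by auto.
  rewrite (bil_comm _ (delta p)), <- Cop_assoc, bil_comm by auto using Cop_summable.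
  unfold bil; rewrite <- sumLC_scal by auto using abs_summable_bil, Cop_summable.
  apply sumLC_ext; intros q.
  fold (coef p (true, 0%Z) (lneg q)); rewrite coef_comm, coef_assoc.
  change (lneg (true, 0%Z)) with (lpow 0); ring.
Qed.

End Completeness.

(** * Solutions of p + q = 1 in the lattice *)

Lemma powerRZ_gt_0 lam n : 1 < lam -> 0 < powerRZ lam n.
Proof. intros; apply powerRZ_lt; lra. Qed.

Lemma powerRZ_mono lam m n : 1 < lam -> (m < n)%Z -> powerRZ lam m < powerRZ lam n.
Proof.
  intros Hlam Hmn; replace n with (m + Z.of_nat (Z.to_nat (n - m)))%Z by lia.
  rewrite powerRZ_add, <- pow_powerRZ by lra.
  rewrite <- (Rmult_1_r (powerRZ lam m)) at 1.
  apply Rmult_lt_compat_l; [now apply powerRZ_gt_0|].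
  apply Rlt_pow_R1; [exact Hlam | lia].
Qed.

Lemma powerRZ_lt_inv lam m n : 1 < lam -> powerRZ lam m < powerRZ lam n -> (m < n)%Z.
Proof.
  intros Hlam Hmn; destruct (Z_lt_le_dec m n) as [H|H]; [exact H|].
  apply Zle_lt_or_eq in H as [H| ->]; [|lra].
  generalize (powerRZ_mono lam n m Hlam H); lra.
Qed.

Lemma lval_inj lam p q : 1 < lam -> lval lam p = lval lam q -> p = q.
Proof.
  intros Hlam; destruct p as [s m], q as [t n]; unfold lval; simpl; intros E.
  assert (Hm := powerRZ_gt_0 lam m Hlam); assert (Hn := powerRZ_gt_0 lam n Hlam).
  destruct (Ztrichotomy m n) as [H|[->|H]]; try apply Z.gt_lt in H;
    try apply (powerRZ_mono lam _ _ Hlam) in H; destruct s, t; try reflexivity; lra.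
Qed.

(* The orbit of the solution [(lam ^ b, - lam ^ a)]; for [lam = 2] and [(a, b) = (0, 1)] every
   solution is listed twice. *)
Definition T6 (a b : nat) : list (Lam * Lam) :=
  let a := Z.of_nat a in let b := Z.of_nat b in
  (lpow b, lnpow a) :: (lnpow a, lpow b) ::
  (lpow (b - a), lnpow (- a)) :: (lnpow (- a), lpow (b - a)) ::
  (lpow (- b), lpow (a - b)) :: (lpow (a - b), lpow (- b)) :: nil.

Lemma rot_T6 a b : map rot (T6 a b) =
  let a := Z.of_nat a in let b := Z.of_nat b in
  (lpow (a - b), lpow (- b)) :: (lpow (b - a), lnpow (- a)) ::
  (lpow (- b), lpow (a - b)) :: (lpow b, lnpow a) ::
  (lnpow a, lpow b) :: (lnpow (- a), lpow (b - a)) :: nil.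
Proof.
  unfold T6, rot, lmul, lneg, linv, lpow, lnpow; simpl; repeat f_equal; lia.
Qed.

Lemma T6_sum lam a b p q : 1 < lam -> lam ^ b - lam ^ a = 1 ->
  In (p, q) (T6 a b) -> lval lam p + lval lam q = 1.
Proof.
  intros Hlam E.
  assert (Ha := pow_lt lam a); assert (Hb := pow_lt lam b).
  unfold T6, lpow, lnpow; simpl; intros H.
  repeat destruct H as [H|H]; try easy; injection H as <- <-; unfold lval; simpl;
    unfold Zminus; rewrite ?powerRZ_add, ?powerRZ_neg', <- ?pow_powerRZ by lra;
    replace (lam ^ b) with (1 + lam ^ a) in * by lra; field; lra.
Qed.

(** The signs of [p] and [q] decide the form of the equation, and both cannot be negative. Dividing
    by the smaller power makes the exponents nonnegative wherever they are not already. *)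
Lemma In_T6 lam p q : 1 < lam -> lval lam p + lval lam q = 1 ->
  exists a b : nat, lam ^ b - lam ^ a = 1 /\ In (p, q) (T6 a b).
Proof.
  intros Hlam; destruct p as [s m], q as [t n]; unfold lval; simpl.
  assert (Hm := powerRZ_gt_0 lam m Hlam); assert (Hn := powerRZ_gt_0 lam n Hlam).
  assert (Hmn : forall i j : Z, powerRZ lam (i - j) * powerRZ lam j = powerRZ lam i).
  { intros i j; rewrite <- powerRZ_add by lra; f_equal; lia. }
  assert (P : forall i : Z, (0 <= i)%Z -> lam ^ Z.to_nat i = powerRZ lam i).
  { intros i Hi; rewrite pow_powerRZ; f_equal; lia. }
  assert (L0 : powerRZ lam 0 = 1) by reflexivity.
  (* Division by [lam^j] gives [lam^(-j) - lam^(i-j) = 1]. *)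
  assert (both : forall i j : Z, (j <= i)%Z -> powerRZ lam i + powerRZ lam j = 1 ->
    lam ^ Z.to_nat (- j) - lam ^ Z.to_nat (i - j) = 1 /\
    (j = - Z.of_nat (Z.to_nat (- j)))%Z /\
    (i = Z.of_nat (Z.to_nat (i - j)) - Z.of_nat (Z.to_nat (- j)))%Z).
  { intros i j Hij E; assert (Hi := powerRZ_gt_0 lam i Hlam).
    assert (Hj := powerRZ_gt_0 lam j Hlam).
    assert (j < 0)%Z by (apply (powerRZ_lt_inv lam); lra).
    split; [|lia]; rewrite !P by lia.
    generalize (Hmn i j) (Hmn 0%Z j); rewrite Z.sub_0_l, L0; intros E1 E2.
    apply (Rmult_eq_reg_r (powerRZ lam j)); [|lra].
    rewrite Rmult_minus_distr_r, E1, E2; lra. }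
  assert (diff : forall i j : Z, powerRZ lam i - powerRZ lam j = 1 ->
    exists a b : nat, lam ^ b - lam ^ a = 1 /\
      ((i = Z.of_nat b)%Z /\ (j = Z.of_nat a)%Z \/
       (i = Z.of_nat b - Z.of_nat a)%Z /\ (j = - Z.of_nat a)%Z)).
  { intros i j E; assert (Hj := powerRZ_gt_0 lam j Hlam).
    assert (j < i)%Z by (apply (powerRZ_lt_inv lam); lra).
    assert (0 < i)%Z by (apply (powerRZ_lt_inv lam); lra).
    (* If [j < 0], division by [lam^j] gives [lam^(i-j) - lam^(-j) = 1]; otherwise [(j, i)] already
       serves as [(a, b)]. *)
    destruct (Z_lt_le_dec j 0) as [Hj0|Hj0].
    - exists (Z.to_nat (- j)), (Z.to_nat (i - j)); split; [|right; lia].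
      rewrite !P by lia.
      generalize (Hmn i j) (Hmn 0%Z j); rewrite Z.sub_0_l, L0; intros E1 E2.
      apply (Rmult_eq_reg_r (powerRZ lam j)); [|lra].
      rewrite Rmult_minus_distr_r, E1, E2; lra.
    - exists (Z.to_nat j), (Z.to_nat i); split; [|left; lia].
      now rewrite !P by lia. }
  unfold T6, lpow, lnpow; destruct s, t; intros E; [lra| | |].
  - destruct (diff n m) as (a & b & E' & [[-> ->]|[-> ->]]); [lra| |];
      exists a, b; simpl; tauto.
  - destruct (diff m n) as (a & b & E' & [[-> ->]|[-> ->]]); [lra| |];
      exists a, b; simpl; tauto.
  - destruct (Z_le_gt_dec n m) as [H|H].
    + destruct (both m n) as (E1 & E2 & E3); [lia|lra|].
      eexists; eexists; split; [exact E1|]; rewrite <- E2, <- E3; simpl; tauto.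
    + destruct (both n m) as (E1 & E2 & E3); [lia|lra|].
      eexists; eexists; split; [exact E1|]; rewrite <- E2, <- E3; simpl; tauto.
Qed.

Lemma is_product_T6 lam a b : 1 < lam -> lam ^ b - lam ^ a = 1 ->
  is_product lam (sum_pairs (T6 a b)).
Proof.
  intros Hlam E; apply is_product_sum_pairs; [lra| | |].
  - intros [p q]; now apply T6_sum.
  - intros F; unfold T6, swap; simpl; ring.
  - intros F; rewrite <- csum_map, rot_T6; unfold T6; simpl; ring.
Qed.

(** [rot] permutes the six pairs in two cycles of length three, and a single [swap] joins the
    cycles. *)
Lemma coef_T6 lam op a b : is_product lam op ->
  exists c : R, forall pq, In pq (T6 a b) -> coef op (fst pq) (snd pq) (lpow 0) = RtoC c.
Proof.
  intros Hop.
  destruct (coef_real lam op Hop (lpow (Z.of_nat b)) (lnpow (Z.of_nat a)) (lpow 0)) as [c Hc].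
  exists c.
  set (K := fun pq : Lam * Lam => coef op (fst pq) (snd pq) (lpow 0)).
  assert (R : map K (map rot (T6 a b)) = map K (T6 a b)).
  { rewrite map_map; apply map_ext; intros [p q]; exact (coef_rot lam op Hop p q). }
  assert (S : K (swap (lpow (Z.of_nat b), lnpow (Z.of_nat a)))
              = K (lpow (Z.of_nat b), lnpow (Z.of_nat a))) by apply (coef_comm lam op Hop).
  change (K (lpow (Z.of_nat b), lnpow (Z.of_nat a)) = RtoC c) in Hc.
  change (forall pq, In pq (T6 a b) -> K pq = RtoC c).
  unfold swap in S; simpl in S; rewrite rot_T6 in R; unfold T6 in R |- *.
  simpl map in R; clearbody K; injection R as R1 R2 R3 R4 R5 R6; intros pq H.
  simpl in H; repeat destruct H as [<-|H]; try easy; congruence.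
Qed.

(** * Products on a lattice whose solutions are listed *)

Definition solutions (lam : R) (S : list (Lam * Lam)) : Prop :=
  NoDup (map fst S) /\ forall p q, In (p, q) S <-> lval lam p + lval lam q = 1.

Lemma double_sumLC lam S (K : Lam -> Lam -> C) : 1 < lam -> solutions lam S ->
  (forall p q, lval lam p + lval lam q <> 1 -> K p q = RtoC 0) ->
  sumLC (fun p => sumLC (fun q => K p q)) = csum S (fun pq => K (fst pq) (snd pq)).
Proof.
  intros Hlam [HN HS] HK.
  rewrite (sumLC_finite (map fst S)); [|exact HN|].
  - rewrite csum_map; apply csum_ext; intros [p q] Hpq; simpl.
    apply (sumLC_single q (fun q => K p q)); intros q' Hq'; apply HK; intros E.
    apply HS in Hpq; apply Hq', (lval_inj lam); [exact Hlam | lra].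
  - intros p Hp; rewrite (sumLC_ext _ (fun _ => RtoC 0)); [apply sumLC_0|].
    intros q; apply HK; intros E; apply Hp.
    now apply (in_map fst _ (p, q)), HS.
Qed.

Lemma prod_gen_sum_pairs lam c S f g k : 1 < lam -> solutions lam S ->
  prod_gen lam c f g k = Cmult (RtoC c) (sum_pairs S f g k).
Proof.
  intros Hlam HS; unfold prod_gen; f_equal.
  rewrite (double_sumLC lam S _ Hlam HS).
  - apply csum_ext; intros [p q] Hpq; apply HS in Hpq; simpl.
    now destruct (Req_dec_T _ _).
  - intros p q Hpq; now destruct (Req_dec_T _ _).
Qed.

Lemma product_expansion lam op S f g k : 1 < lam -> solutions lam S ->
  is_product lam op -> inA f -> inA g ->
  op f g k = csum S (fun pq => Cmult (coef op (fst pq) (snd pq) (lpow 0))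
    (Cmult (f (lmul (fst pq) k)) (g (lmul (snd pq) k)))).
Proof.
  intros Hlam HS Hop Hf Hg.
  rewrite <- (Cop_op lam op Hop) by assumption.
  replace k with (lmul k (lpow 0)) at 1 by (now rewrite lmul_comm, lmul_1_l).
  rewrite (Cop_lmul lam op Hop), (Cop_expansion lam op Hop)
    by auto using abs_summable_lmul, inA_summable.
  rewrite (double_sumLC lam S (fun p q => Cmult (coef op p q (lpow 0))
    (Cmult (f (lmul k p)) (g (lmul k q)))) Hlam HS).
  - apply csum_ext; intros [p q] _; simpl; now rewrite (lmul_comm p), (lmul_comm q).
  - intros p q Hpq; destruct (Ceq_dec (coef op p q (lpow 0)) (RtoC 0)) as [->|H]; [ring|].
    exfalso; apply Hpq; rewrite (coef_support lam op Hop p q (lpow 0) H).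
    unfold lval; simpl; ring.
Qed.

(** [w] stands for the number of times that [T6 a b] lists each solution: [2] for [lam = 2], and [1]
    when [a > 0]. *)
Lemma product_one_orbit lam (a b : nat) (w : R) S : 1 < lam -> lam ^ b - lam ^ a = 1 ->
  solutions lam S -> incl S (T6 a b) -> w <> 0 ->
  (forall f g k, sum_pairs (T6 a b) f g k = Cmult (RtoC w) (sum_pairs S f g k)) ->
  forall op, is_product lam op <-> exists c : R, forall f g, inA f -> inA g -> forall k,
    op f g k = prod_gen lam c f g k.
Proof.
  intros Hlam E HS Hincl Hw HT op; split.
  - intros Hop; destruct (coef_T6 lam op a b Hop) as [c Hc]; exists c.
    intros f g Hf Hg k; rewrite (product_expansion lam op S) by assumption.
    rewrite (prod_gen_sum_pairs lam c S) by assumption.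
    unfold sum_pairs; fold (csum S (fun pq => Cmult (f (lmul (fst pq) k)) (g (lmul (snd pq) k)))).
    rewrite <- csum_scal; apply csum_ext; intros pq Hpq; now rewrite Hc by now apply Hincl.
  - intros [c Hc]; apply (is_product_ext lam op _ Hc).
    assert (H := is_product_T6 lam a b Hlam E).
    (* A scalar multiple is a linear combination with second coefficient [0]; [c / w] undoes the
       repetition. *)
    refine (is_product_ext lam _ _ _ (is_product_lin lam (c / w) 0 _ _ H H)).
    intros f g _ _ k;
    rewrite (prod_gen_sum_pairs lam c S), HT, Cmult_assoc, <- RtoC_mult by assumption.
    replace (c / w * w) with c by (field; exact Hw); ring.
Qed.

Lemma solutions_T6 lam (a b : nat) : 1 < lam -> (0 < a)%nat -> lam ^ b - lam ^ a = 1 ->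
  (forall c d : nat, lam ^ d - lam ^ c = 1 -> c = a /\ d = b) -> solutions lam (T6 a b).
Proof.
  intros Hlam Ha E U.
  assert (Hab : (a < b)%nat).
  { assert (Z.of_nat a < Z.of_nat b)%Z; [|lia].
    apply (powerRZ_lt_inv lam); [exact Hlam|]; rewrite <- !pow_powerRZ; lra. }
  split.
  - unfold T6, lpow, lnpow; simpl.
    repeat (constructor; [simpl; intros H; repeat destruct H as [H|H]; try easy;
      injection H; lia|]); constructor.
  - intros p q; split; [now apply T6_sum|].
    intros Hpq; destruct (In_T6 lam p q Hlam Hpq) as (c & d & Ecd & H).
    now destruct (U c d Ecd) as [-> ->].
Qed.

(** * The individual lattices *)

Lemma products_lam_2 : forall op : binop, is_product 2 op <->
  exists c : R, forall f g, inA f -> inA g -> forall k, op f g k = prod_gen 2 c f g k.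
Proof.
  set (S := (lpow 1, lnpow 0) :: (lnpow 0, lpow 1) :: (lpow (-1), lpow (-1)) :: nil).
  apply (product_one_orbit 2 0 1 2 S); [lra | simpl; ring | | | lra |].
  - split.
    + repeat (constructor; [simpl; intros H; repeat destruct H as [H|H]; easy|]); constructor.
    + intros p q; split; intros Hpq.
      * apply (T6_sum 2 0 1); [lra | simpl; ring|]; simpl in *; tauto.
      * destruct (In_T6 2 p q ltac:(lra) Hpq) as (c & d & Ecd & H).
        assert (Hc : c = 0%nat).
        { destruct c as [|c]; [reflexivity|].
          exfalso; apply (pow_neq_2 2 (Datatypes.S c) d 1); [lra | lia | exact Ecd | ring]. }
        subst c; assert (Hd : d = 1%nat).
        { destruct d as [|[|d]]; [simpl in Ecd; lra | reflexivity|].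
          generalize (pow_R1_Rle 2 d); simpl in Ecd; lra. }
        subst d; unfold T6 in H; simpl in H |- *; tauto.
  - intros pq; unfold S, T6; simpl; tauto.
  - intros f g k; unfold S, T6; simpl.
    apply injective_projections; simpl; ring.
Qed.

(** Elsewhere [lam (lam^2 - 1)] cannot equal [1]: it is at most [0] on [[0, 1]] and below [-1], and
    less than [1] in between. *)
Lemma plastic_gt_1 lam : lam ^ 3 - lam - 1 = 0 -> 1 < lam.
Proof.
  intros H; apply Rnot_le_lt; intros H1.
  assert (E : lam * (lam * lam - 1) = 1) by (simpl in H; lra).
  destruct (Rle_or_lt 0 lam); [nra|]; destruct (Rle_or_lt lam (-1)); [nra|].
  assert (0 < lam * lam) by nra; nra.
Qed.

(** The second trinomial is a multiple of the first: [x^5 - x^4 - 1 = (x^3 - x - 1) (x^2 - x +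
    1)]. *)
Lemma plastic_trinomials lam :
  lam ^ 3 - lam - 1 = 0 -> lam ^ 3 - lam ^ 1 = 1 /\ lam ^ 5 - lam ^ 4 = 1.
Proof.
  intros H; split; [rewrite pow_1; lra|].
  replace (lam ^ 5) with (lam ^ 2 * lam ^ 3) by ring.
  replace (lam ^ 4) with (lam * lam ^ 3) by ring.
  replace (lam ^ 3) with (lam + 1) by lra; lra.
Qed.

Lemma solutions_plastic lam : lam ^ 3 - lam - 1 = 0 -> solutions lam (T1 ++ T2).
Proof.
  intros H; assert (Hlam := plastic_gt_1 lam H).
  destruct (plastic_trinomials lam H) as [E1 E2].
  split.
  - repeat (constructor; [simpl; intros K; repeat destruct K as [K|K]; easy|]); constructor.
  - intros p q; rewrite in_app_iff; split.
    (* [T1] and [T2] are [T6 1 3] and [T6 4 5] by computation. *)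
    + intros [Hpq|Hpq]; [apply (T6_sum lam 1 3) | apply (T6_sum lam 4 5)]; assumption.
    + intros Hpq; destruct (In_T6 lam p q Hlam Hpq) as (c & d & Ecd & K).
      assert (Hc : (0 < c)%nat).
      (* For [c = 0] the equation would be [lam^d = 2]. *)
      { destruct c as [|c]; [|lia].
        exfalso; apply (pow_neq_2 lam 1 3 d Hlam); [lia | exact E1 | simpl in Ecd; lra]. }
      destruct (trinomial_exponents lam 1 3 c d Hlam ltac:(lia) Hc E1 Ecd)
        as [[<- <-]|[(_ & -> & ->)|(? & ? & _)]]; [left|right|lia]; exact K.
Qed.

Theorem theorem2 : forall lam : R,
  ((lam = 2 \/ case_iii lam) ->
     forall op : binop, is_product lam op <->
       exists c : R, forall f g, inA f -> inA g -> forall k,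
         op f g k = prod_gen lam c f g k) /\
  (lam ^ 3 - lam - 1 = 0 ->
     forall op : binop, is_product lam op <->
       exists c1 c2 : R, forall f g, inA f -> inA g -> forall k,
         op f g k = prod_plastic c1 c2 f g k).
Proof.
  intros lam; split.
  - intros [->|(a & b & Hab & _ & Hgcd & N1 & N2 & Hlam & E)]; [exact products_lam_2|].
    symmetry in E.
    destruct (Nat.eq_0_gt_0_cases a) as [->|Ha].
    (* For [a = 0] coprimality forces [b = 1], which is the lattice of [lam = 2]. *)
    { rewrite Nat.gcd_0_l in Hgcd; subst b.
      replace lam with 2 by (simpl in E; lra); exact products_lam_2. }
    apply (product_one_orbit lam a b 1 (T6 a b)); [exact Hlam | exact E | | easy | lra |].
    2: { intros; ring. }
    apply solutions_T6; try assumption; intros c d Ecd.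
    assert (Hc : (0 < c)%nat).
    { destruct c as [|c]; [|lia].
      exfalso; apply (pow_neq_2 lam a b d Hlam Ha E); simpl in Ecd; lra. }
    destruct (trinomial_exponents lam a b c d Hlam Ha Hc E Ecd)
      as [[-> ->]|[(-> & _)|(_ & -> & ->)]]; [easy| |].
    (* Coprimality reduces [(t, 3 t)] and [(4 t, 5 t)] to [t = 1], the two excluded pairs. *)
    + rewrite (Nat.mul_comm 3), Nat.gcd_mul_diag_l in Hgcd by lia; subst a; now destruct N1.
    + assert (c = 1)%nat; [|subst c; now destruct N2].
      rewrite Nat.gcd_mul_mono_r in Hgcd; simpl in Hgcd; lia.
  - intros H op; assert (Hlam := plastic_gt_1 lam H); split.
    + intros Hop; destruct (coef_T6 lam op 1 3 Hop) as [c1 Hc1].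
      destruct (coef_T6 lam op 4 5 Hop) as [c2 Hc2]; exists c1, c2.
      intros f g Hf Hg k.
      rewrite (product_expansion lam op (T1 ++ T2)) by auto using solutions_plastic.
      unfold prod_plastic, sum_pairs; rewrite csum_app.
      fold (csum T1 (fun pq => Cmult (f (lmul (fst pq) k)) (g (lmul (snd pq) k)))).
      fold (csum T2 (fun pq => Cmult (f (lmul (fst pq) k)) (g (lmul (snd pq) k)))).
      rewrite <- !csum_scal; f_equal; apply csum_ext; intros pq Hpq;
        [rewrite Hc1 by exact Hpq | rewrite Hc2 by exact Hpq]; reflexivity.
    + intros (c1 & c2 & Hc); apply (is_product_ext lam op _ Hc).
      destruct (plastic_trinomials lam H) as [E1 E2].
      apply (is_product_lin lam c1 c2 (sum_pairs T1) (sum_pairs T2)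
        (is_product_T6 lam 1 3 Hlam E1) (is_product_T6 lam 4 5 Hlam E2)).
Qed.
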